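(* Let $n\in\mathbb{N}$ and let $k=(k_1,\ldots,k_r)$ with $0<k_r<\cdots<k_1<n$. Then $H^0(\mathbf{F}_{k|k}(\mathfrak{q}_{n|n}(\mathbb{C})))\simeq\mathbb{C}$.
   Context: Supermanifolds are complex-analytic (Berezin–Leites). $H^0$ of a supermanifold denotes the superalgebra of global sections of its structure sheaf. Flag supermanifold $\mathbf{F}^{n|n}_{k|k}$: its reduction is $\mathbf{F}^n_k\times\mathbf{F}^n_k$, where $\mathbf{F}^n_k$ is the usual manifold of flags $\mathbb{C}^n\supset W_1\supset\cdots\supset W_r$, $\dim W_i=k_i$. Atlas: put $k_0=n$. For each $s=1,\ldots,r$ choose $I_{s\bar 0},I_{s\bar 1}\subset\{1,\ldots,k_{s-1}\}$ with $|I_{s\bar 0}|=|I_{s\bar 1}|=k_s$; put $I_s=(I_{s\bar 0},I_{s\bar 1})$, $I=(I_1,\ldots,I_r)$. Let $$Z_{I_s}=\begin{pmatrix}X_s&\Xi_s\\ \mathrm{H}_s&Y_s\end{pmatrix}$$ be of size $2k_{s-1}\times 2k_s$, with all blocks of size $k_{s-1}\times k_s$, such that the rows $i\in I_{s\bar 0}$ and $k_{s-1}+j$, $j\in I_{s\bar 1}$, form the identity matrix. The remaining entries of $X_s,Y_s$ are even coordinates and the remaining entries of $\Xi_s,\mathrm{H}_s$ are odd coordinates of a superdomain $\mathcal{W}_I$ whose reduction is the standard chart given by $I$. Transition functions: $Z_{J_1}=Z_{I_1}C_{I_1J_1}^{-1}$, $Z_{J_s}=C_{I_{s-1}J_{s-1}}Z_{I_s}C_{I_sJ_s}^{-1}$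 for $s\ge2$, where $C_{I_1J_1}$ is the submatrix of $Z_{I_1}$ formed by the rows indexed by $J_1$ and $C_{I_sJ_s}$ is the submatrix of $C_{I_{s-1}J_{s-1}}Z_{I_s}$ formed by the rows indexed by $J_s$. $\mathbf{F}_{k|k}(\mathfrak{q}_{n|n}(\mathbb{C}))$ (supermanifold of $\pi$-symmetric flags) is the subsupermanifold of $\mathbf{F}^{n|n}_{k|k}$ given in these coordinates (in the charts with $I_{s\bar 0}=I_{s\bar 1}$) by $X_s=Y_s$, $\Xi_s=\mathrm{H}_s$, $s=1,\ldots,r$. *)

(* Defs.v *)
From HB Require Import structures.
From mathcomp Require Import all_boot all_order all_algebra.
Set Implicit Arguments.
Unset Strict Implicit.
Unset Printing Implicit Defensive.
Import Order.TTheory GRing.Theory Num.Theory.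
Local Open Scope ring_scope.

(* The Grassmann algebra over K with one anticommuting generator for each
   element of T.  The value of an element at A : {set T} is its coefficient on
   the product of the generators in A, taken in the order of [enum T]. *)
Definition grassmann (K : fieldType) (T : finType) : Type :=
  {ffun {set T} -> K^o}.

Section GrassmannAlgebra.
Variables (K : fieldType) (T : finType).
Local Notation Lam := (grassmann K T).

HB.instance Definition _ := GRing.Lmodule.on Lam.

(* Number of transpositions needed to sort the concatenation of B and C. *)
Definition inversions (B C : {set T}) : nat :=
  (\sum_(b in B) \sum_(c in C) (enum_rank c < enum_rank b))%N.

Definition gr_one : Lam := [ffun A => (A == set0)%:R].
Definition gr_mul (f g : Lam) : Lam :=
  [ffun A : {set T} => \sum_(B : {set T} | B \subset A)
     (-1) ^+ inversions B (A :\: B) * (f B * g (A :\: B))].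

Lemma inversions0l C : inversions set0 C = 0%N.
Proof. by rewrite /inversions big_set0. Qed.
Lemma inversions0r B : inversions B set0 = 0%N.
Proof. by rewrite /inversions big1 // => b _; rewrite big_set0. Qed.

Lemma inversionsDl (B B1 C : {set T}) : B1 \subset B ->
  inversions B C = (inversions B1 C + inversions (B :\: B1) C)%N.
Proof.
by move=> sB; rewrite /inversions (big_setID B1) /= (setIidPr sB).
Qed.
Lemma inversionsDr (B C C1 : {set T}) : C1 \subset C ->
  inversions B C = (inversions B C1 + inversions B (C :\: C1))%N.
Proof.
move=> sC; rewrite /inversions -big_split /=; apply: eq_bigr => b _.
by rewrite (big_setID C1) /= (setIidPr sC).
Qed.

Lemma gr_mulA : associative gr_mul.
Proof.
move=> f g h; apply/ffunP=> A; rewrite !ffunE.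
transitivity (\sum_(D : {set T} | D \subset A)
  \sum_(B : {set T} | (D \subset B) && (B \subset A))
  (-1) ^+ (inversions D (A :\: D) + inversions (B :\: D) (A :\: B)) *
  (f D * (g (B :\: D) * h (A :\: B)))).
- apply: eq_bigr => D sDA; rewrite ffunE !mulr_sumr.
  rewrite (reindex_onto (fun B => B :\: D) (fun E => D :|: E)) /=; last first.
    move=> E sE; apply/setP=> x; rewrite !inE.
    have := subsetP sE x; rewrite inE.
    by case: (x \in D); case: (x \in E) => //= /(_ isT).
  apply: eq_big => [B|B /andP[sB /eqP eB]].
    rewrite setDE setUIr setUCr setIT subsetD; apply/andP/andP.
      case=> /andP[sBA _] /eqP eB; split; first by rewrite -eB subsetUl.
      apply/subsetP => x xB; case xD : (x \in D).
        exact: (subsetP sDA).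
      by apply: (subsetP sBA); rewrite !inE xB xD.
    case=> sDB sBA; split; last by rewrite (setUidPr sDB).
    rewrite (subset_trans (subsetIl _ _) sBA) /=.
    by rewrite disjoints_subset subsetIr.
  have sDB : D \subset B by rewrite -eB subsetUl.
  by rewrite setDDl eB exprD -[RHS]mulrA; congr (_ * _); exact: mulrCA.
rewrite (exchange_big_dep (fun B : {set T} => B \subset A)) /=; last first.
  by move=> D B _ /andP[].
apply: eq_bigr => B sBA; rewrite ffunE mulr_suml mulr_sumr.
apply: eq_big => [D|D /andP[sDA /andP[sDB _]]].
  rewrite sBA andbT; case sDB : (D \subset B); rewrite ?andbF //.
  by rewrite (subset_trans sDB sBA).
have -> : (inversions D (A :\: D) + inversions (B :\: D) (A :\: B) =
   inversions B (A :\: B) + inversions D (B :\: D))%N.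
  rewrite (inversionsDl _ sDB) (@inversionsDr D (A :\: D) (B :\: D)) ?setSD //.
  have -> : (A :\: D) :\: (B :\: D) = A :\: B.
    apply/setP=> x; rewrite !inE; have := subsetP sDB x.
    by case: (x \in D); case: (x \in B); case: (x \in A) => //= /(_ isT).
  by rewrite -addnA addnC.
by rewrite exprD !mulrA.
Qed.

Lemma gr_mul1l : left_id gr_one gr_mul.
Proof.
move=> f; apply/ffunP=> A; rewrite ffunE (bigD1 set0) ?sub0set //=.
rewrite ffunE eqxx inversions0l setD0 expr0 !mul1r big1 ?addr0 // => B.
by case/andP=> _ /negbTE nB; rewrite ffunE nB mul0r mulr0.
Qed.

Lemma gr_mul1r : right_id gr_one gr_mul.
Proof.
move=> f; apply/ffunP=> A; rewrite ffunE (bigD1 A) ?subxx //=.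
rewrite ffunE setDv eqxx inversions0r expr0 mul1r mulr1 big1 ?addr0 // => B.
case/andP=> sB nB; rewrite ffunE setD_eq0 [A \subset B]negbTE ?mulr0 ?mulr0 //.
by apply: contra nB => sA; rewrite eqEsubset sB.
Qed.

Lemma gr_mulDl : left_distributive gr_mul +%R.
Proof.
move=> f g h; apply/ffunP=> A; rewrite !ffunE -big_split /=.
by apply: eq_bigr => B _; rewrite ffunE mulrDl mulrDr.
Qed.

Lemma gr_mulDr : right_distributive gr_mul +%R.
Proof.
move=> f g h; apply/ffunP=> A; rewrite !ffunE -big_split /=.
by apply: eq_bigr => B _; rewrite ffunE !mulrDr.
Qed.

Lemma gr_one_neq0 : gr_one != 0.
Proof. by apply/eqP=> /ffunP/(_ set0)/eqP; rewrite !ffunE eqxx oner_eq0. Qed.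

HB.instance Definition _ := GRing.Zmodule_isNzRing.Build Lam
  gr_mulA gr_mul1l gr_mul1r gr_mulDl gr_mulDr gr_one_neq0.

Lemma gr_scaleAl (a : K) (f g : Lam) : a *: (f * g) = a *: f * g.
Proof.
apply/ffunP=> A; rewrite !ffunE scaler_sumr; apply: eq_bigr => B _.
by rewrite ffunE -mulrA [LHS]mulrCA.
Qed.

HB.instance Definition _ := GRing.Lmodule_isLalgebra.Build K Lam gr_scaleAl.

Lemma gr_scaleAr (a : K) (f g : Lam) : a *: (f * g) = f * (a *: g).
Proof.
apply/ffunP=> A; rewrite !ffunE scaler_sumr; apply: eq_bigr => B _.
by rewrite ffunE [LHS]mulrCA; congr (_ * _); exact: mulrCA.
Qed.

HB.instance Definition _ := GRing.Lalgebra_isAlgebra.Build K Lam gr_scaleAr.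

Definition gr_gen (t : T) : Lam := [ffun A : {set T} => (A == [set t])%:R].

Definition gr_body (f : Lam) : K := f set0.

Definition gr_even (f : Lam) : Prop := forall A : {set T}, odd #|A| -> f A = 0.
End GrassmannAlgebra.

From mathcomp Require Import all_classical all_reals all_analysis complex.
Import numFieldNormedType.Exports.
Local Open Scope classical_set_scope.

Section Superfunctions.
Variable K : numFieldType.

(* Local expansion into a power series in several variables.  The bound on the
   coefficients makes the series absolutely convergent on the open polydisc of
   radius r, so that its sum does not depend on the order of summation. *)
Definition analytic_at (E : finType) (f : (E -> K) -> K) (a : E -> K) : Prop :=
  exists (c : (E -> nat) -> K) (r M : K),
    [/\ 0 < r,
        forall m, `|c m| * r ^+ (\sum_i m i)%N <= M &
        forall h : E -> K, (forall i, `|h i| < r) ->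
          (\sum_(m : {ffun E -> 'I_N})
             c (fun i => m i) * \prod_i h i ^+ m i) @[N --> \oo]
          --> f (fun i => a i + h i)].

(* Functions on the superdomain with even coordinates E, odd coordinates O and
   reduction K^E; the structure sheaf consists of the analytic ones. *)
Definition superfun (E O : finType) : Type := (E -> K) -> grassmann K O.

Definition superanalytic (E O : finType) (F : superfun E O) : Prop :=
  forall (A : {set O}) (a : E -> K), analytic_at (fun x => F x A) a.

Definition partial (E : finType) (i : E) (f : (E -> K) -> K) : (E -> K) -> K :=
  fun x => (fun t : K => f [eta x with i |-> t])^`() (x i).

Definition mpartial (E : finType) (m : E -> nat) (f : (E -> K) -> K) :
    (E -> K) -> K :=
  foldr (fun i g => iter (m i) (partial i) g) f (enum E).

(* F(y, eta) for even elements y and odd elements eta of the Grassmann algebra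
   on T: the coefficients of F are evaluated at y by Taylor expansion at the
   body of y.  An even element with zero body has vanishing power of exponent
   #|T|.+1, so the sum over m contains all nonzero terms. *)
Definition superfun_eval (E O T : finType) (F : superfun E O)
    (y : E -> grassmann K T) (eta : O -> grassmann K T) : grassmann K T :=
  let b i := gr_body (y i) in
  \sum_(A : {set O})
    (\sum_(m : {ffun E -> 'I_#|T|.+1})
       (mpartial (fun i => m i) (fun x => F x A) b / (\prod_i (m i)`!)%:R)
         *: \prod_i (y i - (b i)%:A) ^+ m i)
    * \prod_(j in A) eta j.

(* Gluing data of a supermanifold covered by charts isomorphic to affine
   superspaces.  At a point x of the reduction of chart i lying in chart j,
   [tr_even i j x] and [tr_odd i j x] are the coordinates of chart j expressed
   through those of chart i: elements of the Grassmann algebra on the odd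
   coordinates of chart i, with coefficients taken at x. *)
Record super_atlas := SuperAtlas {
  chart : Type;
  even_coord : chart -> finType;
  odd_coord : chart -> finType;
  overlap : forall i : chart, chart -> set (even_coord i -> K);
  tr_even : forall i j : chart,
    (even_coord i -> K) -> even_coord j -> grassmann K (odd_coord i);
  tr_odd : forall i j : chart,
    (even_coord i -> K) -> odd_coord j -> grassmann K (odd_coord i) }.

#[global] Arguments overlap {s} i j : rename.
#[global] Arguments tr_even {s} i j x _ : rename.
#[global] Arguments tr_odd {s} i j x _ : rename.

Definition cochain (X : super_atlas) : Type :=
  forall i : chart X, superfun (even_coord i) (odd_coord i).

(* The superalgebra of global sections of the structure sheaf, as a subset of
   the superalgebra [cochain X] with its pointwise operations. *)
Definition H0 (X : super_atlas) : set (cochain X) :=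
  [set f | (forall i, superanalytic (f i)) /\
           forall i j x, overlap i j x ->
             f i x = superfun_eval (f j) (tr_even i j x) (tr_odd i j x)].

Definition even_cochain (X : super_atlas) (f : cochain X) : Prop :=
  forall i x, gr_even (f i x).
End Superfunctions.
Arguments H0 {K} X.

Section CochainAlgebra.
Variables (K : numFieldType) (X : super_atlas K).
Local Notation C := (cochain X).

HB.instance Definition _ := gen_eqMixin C.
HB.instance Definition _ := gen_choiceMixin C.

Fact cochain_ext (f g : C) : (forall i x, f i x = g i x) -> f = g.
Proof. by move=> e; apply: functional_extensionality_dep => i; apply/funext. Qed.

Fact cochain_addA : associative (fun f g : C => (fun i x => f i x + g i x) : C).
Proof. by move=> f g h; apply: cochain_ext => i x; rewrite addrA. Qed.
Fact cochain_addC : commutative (fun f g : C => (fun i x => f i x + g i x) : C).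
Proof. by move=> f g; apply: cochain_ext => i x; rewrite addrC. Qed.
Fact cochain_add0 : left_id ((fun _ _ => 0) : C)
  (fun f g : C => (fun i x => f i x + g i x) : C).
Proof. by move=> f; apply: cochain_ext => i x; rewrite add0r. Qed.
Fact cochain_addN : left_inverse ((fun _ _ => 0) : C)
  (fun f : C => (fun i x => - f i x) : C)
  (fun f g : C => (fun i x => f i x + g i x) : C).
Proof. by move=> f; apply: cochain_ext => i x; rewrite addNr. Qed.
HB.instance Definition _ := GRing.isZmodule.Build C
  cochain_addA cochain_addC cochain_add0 cochain_addN.

Fact cochain_mulA : associative (fun f g : C => (fun i x => f i x * g i x) : C).
Proof. by move=> f g h; apply: cochain_ext => i x; rewrite mulrA. Qed.
Fact cochain_mul1l : left_id ((fun _ _ => 1) : C)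
  (fun f g : C => (fun i x => f i x * g i x) : C).
Proof. by move=> f; apply: cochain_ext => i x; rewrite mul1r. Qed.
Fact cochain_mul1r : right_id ((fun _ _ => 1) : C)
  (fun f g : C => (fun i x => f i x * g i x) : C).
Proof. by move=> f; apply: cochain_ext => i x; rewrite mulr1. Qed.
Fact cochain_mulDl :
  left_distributive (fun f g : C => (fun i x => f i x * g i x) : C) +%R.
Proof. by move=> f g h; apply: cochain_ext => i x; apply: mulrDl. Qed.
Fact cochain_mulDr :
  right_distributive (fun f g : C => (fun i x => f i x * g i x) : C) +%R.
Proof. by move=> f g h; apply: cochain_ext => i x; apply: mulrDr. Qed.
HB.instance Definition _ := GRing.Zmodule_isPzRing.Build C
  cochain_mulA cochain_mul1l cochain_mul1r cochain_mulDl cochain_mulDr.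

Fact cochain_scaleA (a b : K) (f : C) :
  ((fun i x => a *: (b *: f i x)) : C) = fun i x => (a * b) *: f i x.
Proof. by apply: cochain_ext => i x; rewrite scalerA. Qed.
Fact cochain_scale1 : left_id 1
  (fun (a : K) (f : C) => (fun i x => a *: f i x) : C).
Proof. by move=> f; apply: cochain_ext => i x; rewrite scale1r. Qed.
Fact cochain_scaleDr : right_distributive
  (fun (a : K) (f : C) => (fun i x => a *: f i x) : C) +%R.
Proof. by move=> a f g; apply: cochain_ext => i x; apply: scalerDr. Qed.
Fact cochain_scaleDl (f : C) : {morph
  (fun a : K => (fun i x => a *: f i x) : C) : a b / a + b}.
Proof. by move=> a b; apply: cochain_ext => i x; apply: scalerDl. Qed.
HB.instance Definition _ := GRing.Zmodule_isLmodule.Build K C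
  cochain_scaleA cochain_scale1 cochain_scaleDr cochain_scaleDl.
End CochainAlgebra.

Section Flags.
Variables (n : nat) (k : seq nat).

(* k_0 = n, and k_s is the s-th entry of k for 0 < s <= size k.  Levels are
   numbered from 0: level s : 'I_(size k) carries the matrix with block rows of
   size k_s and block columns of size k_(s+1). *)
Definition flag_dim (s : nat) : nat := nth 0%N (n :: k) s.
Local Notation kd := flag_dim.

Record flag_index := FlagIndex {
  idx_set : forall s : 'I_(size k), {set 'I_(kd s)};
  idx_card : forall s, #|idx_set s| = kd s.+1 }.

(* The elements of [idx_set I s] in increasing order. *)
Definition idx_enum (I : flag_index) (s : 'I_(size k)) (j : 'I_(kd s.+1)) :
    'I_(kd s) :=
  enum_val (cast_ord (esym (idx_card I s)) j).

Section Transition.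
Variable L : pzRingType.

(* The rows of M indexed by the pair (J0, J1). *)
Definition idx_rows (J0 J1 : flag_index) (s : 'I_(size k)) (p : nat)
    (M : 'M[L]_(kd s + kd s, p)) : 'M[L]_(kd s.+1 + kd s.+1, p) :=
  col_mx (rowsub (idx_enum J0 (s := s)) (usubmx M))
         (rowsub (idx_enum J1 (s := s)) (dsubmx M)).

(* Two-sided inverse of a matrix over a ring that need not be commutative;
   0 if there is none. *)
Definition mx_inv (m : nat) (M : 'M[L]_m) : 'M[L]_m :=
  xget 0 [set N | M *m N = 1%:M /\ N *m M = 1%:M].

(* A matrix has equal diagonal and equal off-diagonal blocks exactly when it is
   fixed by [pi_swap]. *)
Definition pi_swap (m p : nat) (M : 'M[L]_(m + m, p + p)) :
    'M[L]_(m + m, p + p) :=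
  block_mx (drsubmx M) (dlsubmx M) (ursubmx M) (ulsubmx M).

Lemma pi_swapM (m p q : nat) (M : 'M[L]_(m + m, p + p)) (N : 'M[L]_(p + p, q + q)) :
  pi_swap (M *m N) = pi_swap M *m pi_swap N.
Proof.
rewrite -{1}[M]submxK -{1}[N]submxK mulmx_block /pi_swap mulmx_block.
rewrite block_mxKul block_mxKur block_mxKdl block_mxKdr.
by congr block_mx; rewrite addrC.
Qed.

Lemma pi_swap1 (m : nat) : pi_swap (1%:M : 'M[L]_(m + m)) = 1%:M.
Proof.
rewrite {1}scalar_mx_block /pi_swap.
by rewrite block_mxKul block_mxKur block_mxKdl block_mxKdr -scalar_mx_block.
Qed.

Lemma pi_swap_inv (m : nat) (M : 'M[L]_(m + m)) :
  pi_swap M = M -> pi_swap (mx_inv M) = mx_inv M.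
Proof.
move=> sM; rewrite /mx_inv; case: xgetP => [N _ [MN NM] | _]; last first.
  by rewrite -[0]block_mx0 /pi_swap !(block_mxKul, block_mxKur, block_mxKdl, block_mxKdr).
have sMN : M *m pi_swap N = 1%:M by rewrite -{1}sM -pi_swapM MN pi_swap1.
by rewrite -[LHS]mul1mx -NM -mulmxA sMN mulmx1.
Qed.

Lemma pi_swap_rows (J : flag_index) (s : 'I_(size k)) (p : nat)
    (M : 'M[L]_(kd s + kd s, p + p)) :
  pi_swap M = M -> pi_swap (idx_rows J J M) = idx_rows J J M.
Proof.
have rowsE (A B C D : 'M[L]_(kd s, p)) : idx_rows J J (block_mx A B C D) =
    block_mx (rowsub (idx_enum J (s := s)) A) (rowsub (idx_enum J (s := s)) B)
             (rowsub (idx_enum J (s := s)) C) (rowsub (idx_enum J (s := s)) D).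
  rewrite /idx_rows /block_mx col_mxKu col_mxKd.
  by congr col_mx; apply/matrixP => i j; rewrite !mxE; case: (fintype.split j) => j';
    rewrite !mxE.
move=> sM; have eul : drsubmx M = ulsubmx M by rewrite -{2}sM block_mxKul.
have eur : dlsubmx M = ursubmx M by rewrite -{2}sM block_mxKur.
rewrite -[M]submxK eul eur rowsE /pi_swap.
by rewrite !(block_mxKul, block_mxKur, block_mxKdl, block_mxKdr).
Qed.

Variable Z : forall s : 'I_(size k), 'M[L]_(kd s + kd s, kd s.+1 + kd s.+1).
Variables J0 J1 : flag_index.

(* C_(I_s J_s), where Z is the family of coordinate matrices of the chart I;
   the value 1 at s = 0 makes the formulas at the first level instances of the
   general ones. *)
Fixpoint flag_C (s : nat) : (s <= size k)%N -> 'M[L]_(kd s + kd s) :=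
  match s with
  | 0 => fun=> 1%:M
  | s'.+1 => fun lt_s =>
      idx_rows J0 J1 (s := Ordinal lt_s)
        (flag_C (ltnW lt_s) *m Z (Ordinal lt_s))
  end.

Definition flag_trans (s : 'I_(size k)) :
    'M[L]_(kd s + kd s, kd s.+1 + kd s.+1) :=
  flag_C (ltnW (ltn_ord s)) *m Z s *m mx_inv (flag_C (ltn_ord s)).
End Transition.

Lemma pi_swap_flag_trans (L : pzRingType)
    (Z : forall s : 'I_(size k), 'M[L]_(kd s + kd s, kd s.+1 + kd s.+1))
    (J : flag_index) :
  (forall s, pi_swap (Z s) = Z s) ->
  forall s, pi_swap (flag_trans Z J J s) = flag_trans Z J J s.
Proof.
move=> sZ; have sC s (le_s : (s <= size k)%N) :
    pi_swap (flag_C Z J J le_s) = flag_C Z J J le_s.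
  elim: s le_s => [|s IHs] le_s /=; first exact: pi_swap1.
  apply: (@pi_swap_rows L J (Ordinal le_s)).
  by rewrite pi_swapM IHs; congr (_ *m _); exact: (sZ (Ordinal le_s)).
by move=> s; rewrite /flag_trans !pi_swapM sC sZ pi_swap_inv.
Qed.

Section PiSymmetric.
Variable K : numFieldType.

(* Positions of the entries of the blocks X_s (and of the blocks Xi_s) lying
   outside the rows of the identity matrix, all levels taken together. *)
Definition pi_coord (I : flag_index) : finType :=
  {c : {s : 'I_(size k) & ('I_(kd s) * 'I_(kd s.+1))%type} |
    (tagged c).1 \notin idx_set I (tag c)}.

(* The block X_s (for d = 1) or Xi_s (for d = 0) with free entries x. *)
Definition pi_block (L : pzRingType) (I : flag_index) (d : L)
    (x : pi_coord I -> L) (s : 'I_(size k)) : 'M[L]_(kd s, kd s.+1) :=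
  \matrix_(i, j)
    if insub (Tagged (fun s : 'I_(size k) => ('I_(kd s) * 'I_(kd s.+1))%type)
                (i, j)) is Some c
    then x c else if idx_enum I j == i then d else 0.

(* Z_(I_s) with X_s = Y_s and Xi_s = Eta_s. *)
Definition pi_Z (L : pzRingType) (I : flag_index) (x xi : pi_coord I -> L)
    (s : 'I_(size k)) : 'M[L]_(kd s + kd s, kd s.+1 + kd s.+1) :=
  block_mx (pi_block 1 x s) (pi_block 0 xi s)
           (pi_block 0 xi s) (pi_block 1 x s).

(* The coordinate matrices of chart I at x, over the Grassmann algebra on its
   odd coordinates. *)
Definition pi_point (I : flag_index) (x : pi_coord I -> K) :=
  pi_Z (fun c => (x c)%:A : grassmann K (pi_coord I))
       (fun c => gr_gen K c).

Definition pi_overlap (I J : flag_index) : set (pi_coord I -> K) :=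
  [set x | forall s : 'I_(size k),
     map_mx (@gr_body K (pi_coord I))
       (flag_C (pi_point x) J J (ltn_ord s)) \in unitmx].

(* By [pi_swap_flag_trans] the matrices [flag_trans (pi_point x) J J s] are again
   of the form [pi_Z]; the coordinates are read off the upper blocks. *)
Definition pi_tr_even (I J : flag_index) (x : pi_coord I -> K)
    (c : pi_coord J) : grassmann K (pi_coord I) :=
  ulsubmx (flag_trans (pi_point x) J J (tag (val c)))
    (tagged (val c)).1 (tagged (val c)).2.
Definition pi_tr_odd (I J : flag_index) (x : pi_coord I -> K)
    (c : pi_coord J) : grassmann K (pi_coord I) :=
  ursubmx (flag_trans (pi_point x) J J (tag (val c)))
    (tagged (val c)).1 (tagged (val c)).2.

Definition pi_flag : super_atlas K :=
  SuperAtlas pi_overlap pi_tr_even pi_tr_odd.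
End PiSymmetric.
End Flags.

(* Main.v *)
(* A one-parameter subgroup of the diagonal torus of GL_n with weights 0 and 1
   multiplies some coordinates of the chart of the first basis vectors by t, and
   some coordinates of the chart of the last basis vectors by 1/t; all the other
   coordinates of both charts are fixed.  Along an orbit a coefficient of a global
   section is thus an entire function of t which has a limit at infinity, hence
   it is constant (maximum principle).  By induction on the degree in the odd
   coordinates, the coefficients of positive degree vanish, since they come with
   a negative power of t, and the body is invariant under setting coordinates to
   0, so it is constant.  Charts overlap in dense sets, which carries the result
   over to all charts.  Only the component of lowest positive degree has to be
   followed through a transition, so that no derivative of a nonconstant
   function ever contributes. *)
Require Import Defs.
From HB Require Import structures.
From mathcomp Require Import all_boot all_order all_algebra.
Set Implicit Arguments.
Unset Strict Implicit.
Unset Printing Implicit Defensive.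
Import Order.TTheory GRing.Theory Num.Theory.
Local Open Scope ring_scope.

(** * Grassmann algebras and superfunctions *)

(** The obstacle is that the transition functions contain inverses of matrices over a noncommutative
    ring, so they are never written out. Equivariance replaces a formula: conjugating the coordinate
    matrices of a chart by diagonal matrices rescales its even coordinates and its odd generators,
    and a rescaling of generators is an automorphism of the Grassmann algebra, hence commutes with
    forming inverses. The inverse rescaling is left over in the transition functions; this is the
    source of the negative powers of t. The same computation with diag(1, -1) shows that the odd
    transition functions have zero body. The two charts are opposite: in the first one the selected
    rows precede all free rows, in the last one they follow them, so that diag(1,..,1,t,..,t)
    expands one chart and contracts the other. On the analytic side, the restriction of an analytic
    function to a complex line has polynomial approximations of every order with geometric error,
    and the maximum principle is derived from this property alone. *)

Section Grassmann.
Variables (K : fieldType) (T : finType).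
Local Notation Lam := (grassmann K T).
Implicit Types (f g : Lam) (A B : {set T}).

Lemma grD f g A : (f + g) A = f A + g A.
Proof. by rewrite ffunE. Qed.

Lemma grN f A : (- f) A = - f A.
Proof. by rewrite ffunE. Qed.

Lemma gr0 A : (0 : Lam) A = 0.
Proof. by rewrite ffunE. Qed.

Lemma grZ a f A : (a *: f) A = a * f A.
Proof. by rewrite ffunE. Qed.

Lemma gr1 A : (1 : Lam) A = (A == set0)%:R.
Proof. by rewrite ffunE. Qed.

Lemma grM f g A : (f * g) A = \sum_(B : {set T} | B \subset A)
     (-1) ^+ inversions B (A :\: B) * (f B * g (A :\: B)).
Proof. by rewrite ffunE. Qed.

Lemma gr_sum (I : finType) (P : pred I) (F : I -> Lam) A :
  (\sum_(i | P i) F i) A = \sum_(i | P i) F i A.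
Proof.
by elim/big_rec2: _ => [|i x y _ <-]; rewrite ?gr0 ?grD.
Qed.

Fact gr_body_zmod : zmod_morphism (@gr_body K T).
Proof. by move=> f g; rewrite /gr_body grD grN. Qed.
Fact gr_body_monoid : monoid_morphism (@gr_body K T).
Proof.
split=> [|f g]; first by rewrite /gr_body gr1 eqxx.
rewrite /gr_body grM (big_pred1 set0) => [|B]; last by rewrite subset0.
by rewrite set0D inversions0l expr0 mul1r.
Qed.
HB.instance Definition _ := GRing.isZmodMorphism.Build Lam K (@gr_body K T)
  gr_body_zmod.
HB.instance Definition _ := GRing.isMonoidMorphism.Build Lam K (@gr_body K T)
  gr_body_monoid.

Lemma gr_bodyZ a f : gr_body (a *: f) = a * gr_body f.
Proof. exact: grZ. Qed.

Lemma gr_body_alg a : gr_body (a%:A : Lam) = a.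
Proof. by rewrite gr_bodyZ rmorph1 mulr1. Qed.

Lemma gr_body_gen (t : T) : gr_body (gr_gen K t) = 0.
Proof. by rewrite /gr_body ffunE eq_sym -cards_eq0 cards1. Qed.

(** The algebra endomorphism that multiplies each generator [t] by [b t]. *)
Definition gr_scale (b : T -> K) (f : Lam) : Lam :=
  [ffun A : {set T} => (\prod_(t in A) b t) * f A].

Lemma gr_scaleE b f A : gr_scale b f A = (\prod_(t in A) b t) * f A.
Proof. by rewrite ffunE. Qed.

Fact gr_scale_zmod b : zmod_morphism (gr_scale b).
Proof.
by move=> f g; apply/ffunP=> A; rewrite !(gr_scaleE, grD, grN) mulrBr.
Qed.
Fact gr_scale_monoid b : monoid_morphism (gr_scale b).
Proof.
split=> [|f g]; apply/ffunP=> A; rewrite gr_scaleE.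
  by rewrite gr1; case: eqP => [->|_]; rewrite ?mulr0 ?big_set0 ?mulr1.
rewrite !grM mulr_sumr; apply: eq_bigr => B sBA.
rewrite !gr_scaleE (big_setID B) /= (setIidPr sBA) mulrCA; congr (_ * _).
by rewrite mulrACA.
Qed.
HB.instance Definition _ b := GRing.isZmodMorphism.Build Lam Lam (gr_scale b)
  (gr_scale_zmod b).
HB.instance Definition _ b := GRing.isMonoidMorphism.Build Lam Lam (gr_scale b)
  (gr_scale_monoid b).

Lemma gr_scaleZ b a f : gr_scale b (a *: f) = a *: gr_scale b f.
Proof. by apply/ffunP=> A; rewrite gr_scaleE !grZ gr_scaleE mulrCA. Qed.

Lemma gr_scale_gen b t : gr_scale b (gr_gen K t) = b t *: gr_gen K t.
Proof.
apply/ffunP=> A; rewrite gr_scaleE grZ !ffunE.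
by case: eqP => [->|_]; rewrite ?mulr0 // big_set1.
Qed.

Lemma gr_body_scale b f : gr_body (gr_scale b f) = gr_body f.
Proof. by rewrite /gr_body gr_scaleE big_set0 mul1r. Qed.

Lemma gr_scaleK b b' : (forall t, b t * b' t = 1) ->
  cancel (gr_scale b) (gr_scale b').
Proof.
move=> bb f; apply/ffunP=> A; rewrite !gr_scaleE mulrA -big_split /=.
by rewrite big1 ?mul1r // => t _; rewrite mulrC.
Qed.

(** Membership in the p-th power of the ideal generated by the odd generators. *)
Definition gr_ord (p : nat) (f : Lam) : Prop :=
  forall A, (#|A| < p)%N -> f A = 0.

Lemma gr_ord0 f : gr_ord 0 f. Proof. by []. Qed.

Lemma gr_ord_body f : gr_body f = 0 -> gr_ord 1 f.
Proof. by move=> f0 A; rewrite ltnS leqn0 cards_eq0 => /eqP ->. Qed.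

Lemma gr_ordW p q f : (q <= p)%N -> gr_ord p f -> gr_ord q f.
Proof. by move=> lqp fp A /leq_trans/(_ lqp)/fp. Qed.

Lemma gr_ordZ p a f : gr_ord p f -> gr_ord p (a *: f).
Proof. by move=> fp A ltA; rewrite grZ fp ?mulr0. Qed.

Lemma gr_ord_sum p (I : finType) (P : pred I) (F : I -> Lam) :
  (forall i, P i -> gr_ord p (F i)) -> gr_ord p (\sum_(i | P i) F i).
Proof.
by move=> Fp A ltA; rewrite gr_sum big1 // => i Pi; apply: Fp.
Qed.

Lemma gr_ordM p q f g : gr_ord p f -> gr_ord q g -> gr_ord (p + q) (f * g).
Proof.
move=> fp gq A ltA; rewrite grM big1 // => B sBA.
have [ltB|leB] := ltnP #|B| p; first by rewrite fp // mul0r mulr0.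
rewrite gq ?mulr0 // cardsDS // ltn_subLR ?subset_leq_card //.
by apply: leq_trans ltA _; rewrite leq_add2r.
Qed.

Lemma gr_ord_exp p f m : gr_ord p f -> gr_ord (p * m) (f ^+ m).
Proof.
move=> fp; elim: m => [|m IHm]; first by rewrite muln0.
by rewrite exprS mulnS; apply: gr_ordM.
Qed.

Lemma gr_ord_prod (I : finType) (P : pred I) (F : I -> Lam) (d : I -> nat) :
  (forall i, P i -> gr_ord (d i) (F i)) ->
  gr_ord (\sum_(i | P i) d i) (\prod_(i | P i) F i).
Proof.
move=> Fd; elim/big_rec2: _ => [|i x y Pi yx]; first exact: gr_ord0.
by apply: gr_ordM => //; apply: Fd.
Qed.
End Grassmann.

From mathcomp Require Import all_classical all_reals all_analysis complex.
From mathcomp Require Import zify ring lra.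
Import Order.TTheory GRing.Theory Num.Theory.
Local Open Scope classical_set_scope.

(** * Evaluation of superfunctions in lowest degree *)

Section Evaluation.
Variable K : numFieldType.

Lemma partial_cst (E : finType) (i : E) (c : K) :
  partial i (fun=> c) = fun=> 0 :> K.
Proof. by apply/funext => x; rewrite /partial derive1_cst. Qed.

Lemma mpartial_cst (E : finType) (m : E -> nat) (c : K) :
  mpartial m (fun=> c) = fun=> (if [forall i, m i == 0%N] then c else 0).
Proof.
have iterE (i : E) k (b : K) : iter k (partial i) (fun=> b) =
    fun=> (if k == 0%N then b else 0).
  elim: k => // k IHk; rewrite iterS IHk partial_cst.
  by [].
rewrite /mpartial; have -> : [forall i, m i == 0%N] =
    all (fun i => m i == 0%N) (enum E).
  apply/forallP/allP => [m0 i _ //| m0 i]; apply: m0.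
  by rewrite mem_enum.
elim: (enum E) => //= i s ->; rewrite iterE.
by case: eqP => //= _; case: all.
Qed.

Lemma mpartial0 (E : finType) (m : E -> nat) (f : (E -> K) -> K) :
  (forall i, m i = 0%N) -> mpartial m f = f.
Proof. by move=> m0; rewrite /mpartial; elim: (enum E) => //= i s ->; rewrite m0. Qed.

Variables (E O T : finType).
Implicit Types (F : superfun K E O) (y : E -> grassmann K T) (eta : O -> grassmann K T).

(** Congruence to the constant [c] modulo the p-th power of the odd ideal; for p = 0 it says
    nothing. This is the statement that the induction on the degree carries. *)
Definition cst_mod (p : nat) (c : K) F :=
  forall (B : {set O}) x, (#|B| < p)%N -> F x B = (B == finset.set0)%:R * c.

(* Taylor terms of positive order raise the degree in the generators, so that
   only values of the coefficients of degree [p] enter in degree [p]. *)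
Lemma superfun_eval_lowest F y eta (p : nat) (c : K) (A : {set T}) :
  (forall j, gr_body (eta j) = 0) -> cst_mod p c F -> #|A| = p ->
  superfun_eval F y eta A =
  \sum_(B : {set O} | #|B| == p)
     F (fun i => gr_body (y i)) B * (\prod_(j in B) eta j) A.
Proof.
move=> eta0 Fp Ap; rewrite /superfun_eval gr_sum [RHS]big_mkcond /=.
apply: eq_bigr => B _; set b := fun i => gr_body (y i).
set P := \prod_(j in B) eta j.
have Pord : gr_ord #|B| P.
  by rewrite -sum1_card; apply: gr_ord_prod => j _; apply: gr_ord_body.
pose m0 : {ffun E -> 'I_#|T|.+1} := [ffun=> ord0].
have m0P (m : {ffun E -> 'I_#|T|.+1}) : m != m0 -> exists i, (0 < m i)%N.
  move=> mm0; apply/existsP; apply: contraNT mm0 => /existsPn mz.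
  apply/eqP/ffunP => i; apply/val_inj; rewrite /= ffunE /=.
  by apply/eqP; rewrite -leqn0 leqNgt mz.
pose term (m : {ffun E -> 'I_#|T|.+1}) :=
  (mpartial (fun i => m i) (fun x => F x B) b / (\prod_i (m i)`!)%:R)
         *: \prod_i (y i - (b i)%:A) ^+ m i.
have term0 : term m0 = F b B *: 1.
  rewrite /term mpartial0; last by move=> i; rewrite ffunE.
  rewrite big1 ?divr1 => [|i _]; last by rewrite ffunE.
  by rewrite big1 // => i _; rewrite ffunE.
have ordN m : m != m0 -> gr_ord 1 (term m).
  move=> /m0P[i mi]; apply: gr_ordZ.
  have : gr_ord (\sum_i 1 * m i) (\prod_i (y i - (b i)%:A) ^+ m i).
    apply: gr_ord_prod => j _; apply: gr_ord_exp; apply: gr_ord_body.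
    by rewrite rmorphB /= gr_body_alg subrr.
  by apply: gr_ordW; rewrite (bigD1 i) //= mul1n ltn_addr.
rewrite -[\sum_(m : {ffun E -> _}) _]/(\sum_m term m).
rewrite (bigD1 m0) //= term0 mulrDl grD -scalerAl mul1r grZ.
(* Below degree p the coefficient is constant in x, so its derivatives vanish, and for empty [B] the
   product of the etas is 1, without component in the positive degree p. Above p the product of the
   etas already has too high an order; in degree p this happens as soon as a Taylor term of positive
   order is multiplied in. *)
case: (ltngtP #|B| p) => [ltB|gtB|eqB].
- have FB : (fun x => F x B) = fun=> (B == finset.set0)%:R * c.
    by apply/funext=> x; rewrite Fp.
  rewrite big1 => [|m mm0]; last first.
    rewrite /term FB mpartial_cst; have [i mi] := m0P m mm0.
    case: forallP => [/(_ i)|_]; first by case: (nat_of_ord _) mi.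
    by rewrite mul0r scale0r.
  rewrite mul0r gr0 addr0 Fp //; case: eqP => [B0|_]; last by rewrite !mul0r.
  rewrite /P B0 finset.big_set0 gr1 -cards_eq0 Ap.
  by move: ltB; rewrite B0 cards0; case: (p) => //= p' _; rewrite mulr0.
- rewrite Pord ?Ap // mulr0 add0r.
  apply: (@gr_ordM _ _ 0 #|B|) => //; by rewrite add0n Ap.
- rewrite -[RHS]addr0; congr (_ + _).
  apply: (@gr_ordM _ _ 1 #|B|) => //; last by rewrite eqB Ap.
  by apply: gr_ord_sum => m mm0; apply: ordN.
Qed.

Lemma superfun_eval_cst (c : K) y eta :
  superfun_eval (fun=> c%:A) y eta = c%:A.
Proof.
rewrite /superfun_eval (bigD1 finset.set0) //= finset.big_set0 mulr1.
rewrite [X in _ + X]big1 ?addr0 => [|A A0]; last first.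
  rewrite big1 ?mul0r // => m _.
  have -> : (fun x : E -> K => (c%:A : grassmann K O) A) = fun=> 0.
    by apply/funext => x; rewrite grZ gr1 (negbTE A0) mulr0.
  by rewrite mpartial_cst if_same mul0r scale0r.
rewrite (bigD1 [ffun=> ord0]) //= [X in _ + X]big1 ?addr0.
  rewrite mpartial0 => [|i]; last by rewrite ffunE.
  rewrite grZ gr1 eqxx mulr1 big1 ?divr1 => [|i _]; last by rewrite ffunE.
  by rewrite big1 // => i _; rewrite ffunE.
move=> m mm0.
rewrite mpartial_cst; case: forallP => [mz|_]; last by rewrite mul0r scale0r.
case/eqP: mm0; apply/ffunP => i; rewrite ffunE; apply/val_inj/eqP.
exact: mz.
Qed.
End Evaluation.

(** * The torus action on transition functions *)

Section MatrixInverse.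
Variable L : pzRingType.

Lemma mx_inv_eq m (M N : 'M[L]_m) : M *m N = 1%:M -> N *m M = 1%:M ->
  mx_inv M = N.
Proof.
move=> MN NM; rewrite /mx_inv; case: xgetP => [N' _ [MN' _]|/(_ N)]; last by case.
by rewrite -[RHS]mulmx1 -MN' mulmxA NM mul1mx.
Qed.

Lemma mx_inv_out m (M : 'M[L]_m) :
  ~ (exists N, M *m N = 1%:M /\ N *m M = 1%:M) -> mx_inv M = 0.
Proof.
by move=> nM; rewrite /mx_inv; case: xgetP => // N _ MN; case: nM; exists N.
Qed.

(** Multiplication by invertible matrices preserves both the existence and the absence of an
    inverse; in the second case both sides are the default value 0. *)
Lemma mx_inv_conj m (U U' V V' M : 'M[L]_m) :
  U *m U' = 1%:M -> U' *m U = 1%:M -> V *m V' = 1%:M -> V' *m V = 1%:M ->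
  mx_inv (U *m M *m V) = V' *m mx_inv M *m U'.
Proof.
move=> UU' U'U VV' V'V.
have [[N [MN NM]]|nM] := pselect (exists N, M *m N = 1%:M /\ N *m M = 1%:M).
  rewrite (mx_inv_eq MN NM); apply: mx_inv_eq.
    by rewrite !mulmxA -(mulmxA _ V) VV' mulmx1 -(mulmxA U) MN mulmx1.
  by rewrite !mulmxA -(mulmxA _ U') U'U mulmx1 -(mulmxA V') NM mulmx1.
rewrite (mx_inv_out nM) mulmx0 mul0mx; apply: mx_inv_out => -[N [MN NM]].
apply: nM; exists (V *m N *m U); split.
  have -> : M *m (V *m N *m U) = U' *m (U *m M *m V *m N) *m U.
    by rewrite !mulmxA U'U mul1mx.
  by rewrite MN mulmx1.
have -> : V *m N *m U *m M = V *m (N *m (U *m M *m V)) *m V'.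
  by rewrite !mulmxA -(mulmxA _ V V') VV' mulmx1.
by rewrite NM mulmx1.
Qed.
End MatrixInverse.

(** A mere morphism can make a matrix invertible, where [mx_inv] would jump from its default 0 to an
    inverse; an isomorphism cannot. *)
Lemma map_mx_inv (L L' : pzRingType) (f : {rmorphism L -> L'})
    (g : {rmorphism L' -> L}) m (M : 'M[L]_m) :
  cancel f g -> cancel g f -> map_mx f (mx_inv M) = mx_inv (map_mx f M).
Proof.
move=> fK gK.
have gfK p q (N : 'M[L]_(p, q)) : map_mx g (map_mx f N) = N.
  by apply/matrixP => i j; rewrite !mxE fK.
have fgK p q (N : 'M[L']_(p, q)) : map_mx f (map_mx g N) = N.
  by apply/matrixP => i j; rewrite !mxE gK.
have [[N [MN NM]]|nM] := pselect (exists N, M *m N = 1%:M /\ N *m M = 1%:M).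
  rewrite (mx_inv_eq MN NM); apply/esym/mx_inv_eq; rewrite -map_mxM.
    by rewrite MN map_mx1.
  by rewrite NM map_mx1.
rewrite (mx_inv_out nM) map_mx0; apply/esym/mx_inv_out => -[N [MN NM]].
apply: nM; exists (map_mx g N); split; apply: (can_inj (gfK _ _)).
  by rewrite map_mxM fgK MN map_mx1.
by rewrite map_mxM fgK NM map_mx1.
Qed.

Section BlockDiagonal.
Variables (K : fieldType) (L : algType K).

(** Separate factors for the even and the odd rows make diag(1, -1), which realises parity, an
    instance beside the torus elements, which have [b0 = b1]. *)
Definition scale_mx m (b0 b1 : 'I_m -> K) : 'M[L]_(m + m) :=
  block_mx (diag_mx (\row_i (b0 i)%:A)) 0 0 (diag_mx (\row_i (b1 i)%:A)).

Lemma mul_diagA m p (b : 'I_m -> K) (A : 'M[L]_(m, p)) :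
  diag_mx (\row_i (b i)%:A) *m A = \matrix_(i, j) (b i *: A i j).
Proof.
apply/matrixP => i j; rewrite !mxE (bigD1 i) //= big1 => [|l li].
  by rewrite !mxE eqxx mulr1n addr0 -scalerAl mul1r.
by rewrite !mxE eq_sym (negbTE li) mulr0n mul0r.
Qed.

Lemma mul_mx_diagA m p (b : 'I_p -> K) (A : 'M[L]_(m, p)) :
  A *m diag_mx (\row_i (b i)%:A) = \matrix_(i, j) (b j *: A i j).
Proof.
apply/matrixP => i j; rewrite !mxE (bigD1 j) //= big1 => [|l li].
  by rewrite !mxE eqxx mulr1n addr0 -scalerAr mulr1.
by rewrite !mxE (negbTE li) mulr0n mulr0.
Qed.

Lemma scale_mx_conj m p (b0 b1 : 'I_m -> K) (c0 c1 : 'I_p -> K)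
    (A B C D : 'M[L]_(m, p)) :
  scale_mx b0 b1 *m block_mx A B C D *m scale_mx c0 c1 =
  block_mx (\matrix_(i, j) ((b0 i * c0 j) *: A i j))
           (\matrix_(i, j) ((b0 i * c1 j) *: B i j))
           (\matrix_(i, j) ((b1 i * c0 j) *: C i j))
           (\matrix_(i, j) ((b1 i * c1 j) *: D i j)).
Proof.
rewrite !mulmx_block !mul0mx !mulmx0 !addr0 !add0r.
rewrite !mul_mx_diagA !mul_diagA.
by congr block_mx; apply/matrixP => i j; rewrite !mxE scalerA mulrC.
Qed.

Lemma scale_mxK m (b0 b1 : 'I_m -> K) :
  (forall i, b0 i != 0) -> (forall i, b1 i != 0) ->
  scale_mx b0 b1 *m scale_mx (fun i => (b0 i)^-1) (fun i => (b1 i)^-1) = 1%:M.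
Proof.
move=> b0n b1n; rewrite /scale_mx mulmx_block !mul0mx !mulmx0 !addr0 !add0r.
rewrite !mul_diagA [RHS]scalar_mx_block.
congr block_mx; apply/matrixP => i j; rewrite !mxE;
  by case: eqP => [->|]; rewrite ?mulr0n ?scaler0 // mulr1n scalerA divff ?scale1r.
Qed.

Lemma scale_mxVK m (b0 b1 : 'I_m -> K) :
  (forall i, b0 i != 0) -> (forall i, b1 i != 0) ->
  scale_mx (fun i => (b0 i)^-1) (fun i => (b1 i)^-1) *m scale_mx b0 b1 = 1%:M.
Proof.
move=> b0n b1n; rewrite -[RHS](@scale_mxK _ (fun i => (b0 i)^-1) (fun i => (b1 i)^-1));
  try by move=> i; rewrite invr_eq0.
by congr (_ *m scale_mx _ _); apply/funext => i; rewrite invrK.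
Qed.
End BlockDiagonal.

(** * Equivariance of the flag transition matrices *)

Section FlagAlgebra.
Variables (n : nat) (k : seq nat).
Local Notation kd := (flag_dim n k).
Local Notation flag_index := (flag_index n k).

Section Naturality.
Variables (L L' : pzRingType) (f : {rmorphism L -> L'}).

Lemma map_idx_rows (J : flag_index) (s : 'I_(size k)) p (M : 'M[L]_(kd s + kd s, p)) :
  map_mx f (idx_rows J J M) = idx_rows J J (map_mx f M).
Proof.
rewrite /idx_rows map_col_mx; congr col_mx;
  by apply/matrixP => i j; rewrite !mxE.
Qed.

Lemma map_flag_C (Z : forall s : 'I_(size k), 'M[L]_(kd s + kd s, kd s.+1 + kd s.+1))
    (J : flag_index) s (le_s : (s <= size k)%N) :
  map_mx f (flag_C Z J J le_s) = flag_C (fun s => map_mx f (Z s)) J J le_s.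
Proof.
elim: s le_s => [|s IHs] le_s /=; first by rewrite map_mx1.
by rewrite (@map_idx_rows J (Ordinal le_s)) map_mxM IHs.
Qed.

Lemma map_pi_Z (I : flag_index) (x xi : pi_coord I -> L) (s : 'I_(size k)) :
  map_mx f (pi_Z x xi s) = pi_Z (f \o x) (f \o xi) s.
Proof.
rewrite /pi_Z map_block_mx; congr block_mx; apply/matrixP => i j; rewrite !mxE;
  case: insubP => //= _; case: ifP; by rewrite ?rmorph1 ?rmorph0.
Qed.
End Naturality.

Lemma map_flag_trans (L L' : pzRingType) (f : {rmorphism L -> L'})
    (g : {rmorphism L' -> L})
    (Z : forall s : 'I_(size k), 'M[L]_(kd s + kd s, kd s.+1 + kd s.+1))
    (J : flag_index) s : cancel f g -> cancel g f ->
  map_mx f (flag_trans Z J J s) = flag_trans (fun s => map_mx f (Z s)) J J s.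
Proof.
move=> fK gK; rewrite /flag_trans !map_mxM map_flag_C.
by rewrite (map_mx_inv _ fK gK) map_flag_C.
Qed.

Lemma eq_flag_C (L : pzRingType)
    (Z Z' : forall s : 'I_(size k), 'M[L]_(kd s + kd s, kd s.+1 + kd s.+1))
    (J : flag_index) s (le_s : (s <= size k)%N) :
  (forall s' : 'I_(size k), (s' < s)%N -> Z s' = Z' s') ->
  flag_C Z J J le_s = flag_C Z' J J le_s.
Proof.
elim: s le_s => [//|s IHs] le_s ZZ' /=.
rewrite ZZ' // (IHs (ltnW le_s)) // => s' lts; apply: ZZ'.
exact: leqW.
Qed.

Lemma idx_rowsM (L : pzRingType) (J : flag_index) (s : 'I_(size k)) p q
    (M : 'M[L]_(kd s + kd s, p)) (N : 'M[L]_(p, q)) :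
  idx_rows J J (M *m N) = idx_rows J J M *m N.
Proof.
rewrite /idx_rows mul_col_mx; congr col_mx; apply/matrixP => i j;
  by rewrite !mxE; apply: eq_bigr => l _; rewrite !mxE.
Qed.

Lemma idx_rows_block (L : pzRingType) (J : flag_index) (s : 'I_(size k)) p
    (A B C D : 'M[L]_(kd s, p)) :
  idx_rows J J (block_mx A B C D) =
    block_mx (rowsub (idx_enum J (s := s)) A) (rowsub (idx_enum J (s := s)) B)
             (rowsub (idx_enum J (s := s)) C) (rowsub (idx_enum J (s := s)) D).
Proof.
rewrite /idx_rows /block_mx col_mxKu col_mxKd.
by congr col_mx; apply/matrixP => i j; rewrite !mxE; case: (fintype.split j) => j';
  rewrite !mxE.
Qed.

Section Torus.
Variable K : numFieldType.

(* A torus element multiplies row [i] of the matrix of level [s] by [a s i], and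
   divides the columns by the factors of the rows that [J] selects. *)
Definition torus_rows (J : flag_index) (a : forall s, 'I_(kd s) -> K) : Prop :=
  forall (s : 'I_(size k)) (j : 'I_(kd s.+1)), a s.+1 j = a s (idx_enum J j).

Variables (L : algType K) (J : flag_index).
Variables (a0 a1 a0' a1' : forall s, 'I_(kd s) -> K).
Arguments a0 {s} _.
Arguments a1 {s} _.
Arguments a0' {s} _.
Arguments a1' {s} _.
Hypothesis a0_neq0 : forall s i, @a0 s i != 0.
Hypothesis a1_neq0 : forall s i, @a1 s i != 0.
Hypothesis a0'_neq0 : forall s i, @a0' s i != 0.
Hypothesis a1'_neq0 : forall s i, @a1' s i != 0.
Hypothesis Ja0' : torus_rows J (@a0').
Hypothesis Ja1' : torus_rows J (@a1').
Hypothesis a0'_0 : @a0' 0 =1 @a0 0.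
Hypothesis a1'_0 : @a1' 0 =1 @a1 0.
Local Notation D s := (scale_mx L (@a0 s) (@a1 s)).
Local Notation Dv s := (scale_mx L (fun i => (@a0 s i)^-1) (fun i => (@a1 s i)^-1)).
Local Notation D' s := (scale_mx L (@a0' s) (@a1' s)).
Local Notation Dv' s := (scale_mx L (fun i => (@a0' s i)^-1) (fun i => (@a1' s i)^-1)).

Variable Z : forall s : 'I_(size k), 'M[L]_(kd s + kd s, kd s.+1 + kd s.+1).

Lemma idx_rows_scale (s : 'I_(size k)) p (M : 'M[L]_(kd s + kd s, p + p)) :
  idx_rows J J (D' s *m M) = D' s.+1 *m idx_rows J J M.
Proof.
rewrite -[M]submxK idx_rows_block !mulmx_block !mul0mx !add0r !addr0.
rewrite idx_rows_block !mul_diagA.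
by congr block_mx; apply/matrixP => i j; rewrite !mxE -?Ja0' -?Ja1'.
Qed.

(** In the recursion the factors [Dv s] and [D s] of consecutive levels cancel, and selecting the
    rows of [J] turns the left factor [D' s] into [D' s.+1]. *)
Lemma flag_C_torus s (le_s : (s <= size k)%N) :
  flag_C (fun s => D s *m Z s *m Dv s.+1) J J le_s =
  D' s *m flag_C Z J J le_s *m Dv s.
Proof.
elim: s le_s => [|s IHs] le_s /=.
  by rewrite mulmx1 (funext a0'_0) (funext a1'_0) scale_mxK.
rewrite -(@idx_rows_scale (Ordinal le_s)) -(@idx_rowsM _ _ (Ordinal le_s)).
rewrite IHs; apply: (congr1 (@idx_rows _ _ _ J J (Ordinal le_s) _)).
rewrite [RHS]/= !mulmxA; congr (_ *m _ *m _).
by rewrite -[_ *m Dv s *m D s]mulmxA scale_mxVK // mulmx1.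
Qed.

(** The weights of the source chart cancel between C, Z and the inverse. What remains is the
    transformation law of the coordinate matrices of [J] under its own weights. *)
Lemma flag_trans_torus (s : 'I_(size k)) :
  flag_trans (fun s => D s *m Z s *m Dv s.+1) J J s =
  D' s *m flag_trans Z J J s *m Dv' s.+1.
Proof.
rewrite /flag_trans !flag_C_torus.
rewrite (@mx_inv_conj _ _ _ (Dv' s.+1) _ (D s.+1)) ?scale_mxK ?scale_mxVK //.
rewrite !mulmxA -[_ *m Dv s *m D s]mulmxA scale_mxVK // mulmx1.
by rewrite -[_ *m Dv s.+1 *m D s.+1]mulmxA scale_mxVK // mulmx1.
Qed.
End Torus.
End FlagAlgebra.

Section PiTorus.
Variables (n : nat) (k : seq nat) (K : numFieldType).
Local Notation kd := (flag_dim n k).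
Local Notation flag_index := (flag_index n k).
Implicit Types I J : flag_index.

Definition coord_row I (c : pi_coord I) : 'I_(kd (tag (val c))) :=
  (tagged (val c)).1.
Definition coord_col I (c : pi_coord I) : 'I_(kd (tag (val c)).+1) :=
  (tagged (val c)).2.

(** The odd entries of [pi_point] are the generators at every point, so the factors [o] that
    conjugation puts on them have to be removed by an automorphism of the Grassmann algebra; the
    even entries are scalars and keep their factors [e]. On the identity rows [torus_rows] makes the
    factor 1. Each of [e] and [o] is prescribed twice because a pi-symmetric matrix shows every
    coordinate in two blocks. *)
Lemma pi_point_torus I (x : pi_coord I -> K) (a0 a1 : forall s, 'I_(kd s) -> K)
    (e o : pi_coord I -> K) (s : 'I_(size k)) :
  (forall s i, a0 s i != 0) -> (forall s i, a1 s i != 0) ->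
  torus_rows I a0 -> torus_rows I a1 ->
  (forall c, e c = a0 _ (coord_row c) / a0 _ (coord_col c)) ->
  (forall c, e c = a1 _ (coord_row c) / a1 _ (coord_col c)) ->
  (forall c, o c = a0 _ (coord_row c) / a1 _ (coord_col c)) ->
  (forall c, o c = a1 _ (coord_row c) / a0 _ (coord_col c)) ->
  pi_point (fun c => e c * x c) s =
  map_mx (gr_scale (fun c => (o c)^-1))
    (scale_mx (grassmann K (pi_coord I)) (@a0 s) (@a1 s) *m pi_point x s *m
     scale_mx _ (fun i => (@a0 s.+1 i)^-1) (fun i => (@a1 s.+1 i)^-1)).
Proof.
move=> a0n a1n Ia0 Ia1 e0 e1 o0 o1; rewrite /pi_point /pi_Z scale_mx_conj.
rewrite map_block_mx.
have on c : o c != 0 by rewrite o0 mulf_neq0 ?invr_eq0.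
congr block_mx; apply/matrixP => i j; rewrite !mxE.
- case: insubP => [c _ ec|_].
    have := e0 c; rewrite /coord_row /coord_col ec /= => <-.
    by rewrite !gr_scaleZ rmorph1 scalerA.
  case: eqP => [<-|_]; rewrite gr_scaleZ ?rmorph0 ?scaler0 // rmorph1.
  by rewrite -Ia0 divff ?scale1r.
- case: insubP => [c _ ec|_].
    have := o0 c; rewrite /coord_row /coord_col ec /= => <-.
    by rewrite gr_scaleZ gr_scale_gen scalerA divff ?scale1r.
  by rewrite if_same gr_scaleZ rmorph0 scaler0.
- case: insubP => [c _ ec|_].
    have := o1 c; rewrite /coord_row /coord_col ec /= => <-.
    by rewrite gr_scaleZ gr_scale_gen scalerA divff ?scale1r.
  by rewrite if_same gr_scaleZ rmorph0 scaler0.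
- case: insubP => [c _ ec|_].
    have := e1 c; rewrite /coord_row /coord_col ec /= => <-.
    by rewrite !gr_scaleZ rmorph1 scalerA.
  case: eqP => [<-|_]; rewrite gr_scaleZ ?rmorph0 ?scaler0 // rmorph1.
  by rewrite -Ia1 divff ?scale1r.
Qed.

Lemma gr_scaleV (T : finType) (o : T -> K) : (forall t, o t != 0) ->
  cancel (gr_scale (fun t => (o t)^-1)) (gr_scale o) /\
  cancel (gr_scale o) (gr_scale (fun t => (o t)^-1)).
Proof. by move=> on; split; apply: gr_scaleK => t; rewrite ?mulVf ?mulfV. Qed.

(* The parity automorphism of the Grassmann algebra acts on the transition
   matrices as conjugation by diag(1, -1). *)
Lemma gr_body_tr_odd I J (x : pi_coord I -> K) (c : pi_coord J) :
  gr_body (pi_tr_odd x c) = 0.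
Proof.
pose a0 s (i : 'I_(kd s)) : K := 1; pose a1 s (i : 'I_(kd s)) : K := -1.
have a0n s (i : 'I_(kd s)) : a0 s i != 0 by exact: oner_neq0.
have N1 : -1 != 0 :> K by rewrite oppr_eq0 oner_neq0.
have a1n s (i : 'I_(kd s)) : a1 s i != 0 by exact: N1.
have [K1 K2] := @gr_scaleV (pi_coord I) (fun=> -1) (fun=> N1).
have xE : pi_point x = fun s => map_mx (gr_scale (fun=> (-1)^-1))
    (scale_mx (grassmann K (pi_coord I)) (@a0 s) (@a1 s) *m pi_point x s *m
     scale_mx _ (fun i => (@a0 s.+1 i)^-1) (fun i => (@a1 s.+1 i)^-1)).
  apply: functional_extensionality_dep => s.
  rewrite -(@pi_point_torus I x a0 a1 (fun=> 1) (fun=> -1)) //.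
  - by congr (pi_point _ s); apply/funext => c'; rewrite mul1r.
  - by move=> c'; rewrite divff.
  - by move=> c'; rewrite divff.
  - by move=> c'; rewrite /a0 /a1 div1r invrN invr1.
  - by move=> c'; rewrite /a0 /a1 divr1.
rewrite /pi_tr_odd; set s := tag (val c); set i := (tagged (val c)).1.
set j := (tagged (val c)).2.
have := map_flag_trans (fun s =>
     scale_mx (grassmann K (pi_coord I)) (@a0 s) (@a1 s) *m pi_point x s *m
     scale_mx _ (fun i => (@a0 s.+1 i)^-1) (fun i => (@a1 s.+1 i)^-1)) J s K1 K2.
rewrite -xE (@flag_trans_torus _ _ _ _ J a0 a1 a0 a1) //.
set M := flag_trans _ _ _ _ => ME.
(* Rescaling generators leaves the body alone, while conjugation by diag(1, -1) changes the sign of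
   the off-diagonal blocks. *)
have : gr_body (ursubmx M i j) = - gr_body (ursubmx M i j).
  rewrite -[in LHS]ME -[M in scale_mx _ _ _ *m M]submxK scale_mx_conj.
  rewrite map_block_mx block_mxKur !mxE gr_body_scale gr_bodyZ /a0 /a1.
  by rewrite mul1r invrN invr1 mulN1r.
by move/eqP; rewrite -addr_eq0 -mulr2n mulrn_eq0 /= => /eqP.
Qed.

Section TwoCharts.
Variables (I J : flag_index) (a a' : forall s, 'I_(kd s) -> K).
Arguments a : clear implicits.
Arguments a' : clear implicits.
Hypothesis an : forall s i, a s i != 0.
Hypothesis a'n : forall s i, a' s i != 0.
Hypothesis Ia : torus_rows I a.
Hypothesis Ja' : torus_rows J a'.
Hypothesis a'0 : a' 0 =1 a 0.

Definition torus_weight H (b : forall s, 'I_(kd s) -> K) (c : pi_coord H) : K :=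
  b _ (coord_row c) / b _ (coord_col c).
Local Notation e := (@torus_weight I a).
Local Notation e' := (@torus_weight J a').

Variable x : pi_coord I -> K.

Let D (s : 'I_(size k)) := scale_mx (grassmann K (pi_coord I)) (@a s) (@a s) *m pi_point x s *m
     scale_mx _ (fun i => (@a s.+1 i)^-1) (fun i => (@a s.+1 i)^-1).

Let en c : e c != 0.
Proof. by rewrite mulf_neq0 ?invr_eq0. Qed.

Let xE : pi_point (fun c => e c * x c) =
  fun s => map_mx (gr_scale (fun c => (e c)^-1)) (D s).
Proof.
by apply: functional_extensionality_dep => s; apply: pi_point_torus.
Qed.

Let transE (s : 'I_(size k)) :
  flag_trans (pi_point (fun c => e c * x c)) J J s =
  map_mx (gr_scale (fun c => (e c)^-1))
    (scale_mx (grassmann K (pi_coord I)) (@a' s) (@a' s) *m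
     flag_trans (pi_point x) J J s *m
     scale_mx _ (fun i => (@a' s.+1 i)^-1) (fun i => (@a' s.+1 i)^-1)).
Proof.
have [K1 K2] := gr_scaleV en.
by rewrite xE -(map_flag_trans _ _ _ K1 K2) (@flag_trans_torus _ _ _ _ J a a a' a').
Qed.

(** The action is diagonal in both charts, but the coefficient on a product of generators also
    acquires the inverses of their weights. *)
Lemma pi_tr_even_torus (c : pi_coord J) :
  pi_tr_even (fun c => e c * x c) c =
  e' c *: gr_scale (fun c => (e c)^-1) (pi_tr_even x c).
Proof.
rewrite /pi_tr_even transE -[M in scale_mx _ _ _ *m M]submxK scale_mx_conj.
rewrite map_block_mx block_mxKul 2!mxE.
exact: gr_scaleZ.
Qed.

Lemma pi_tr_odd_torus (c : pi_coord J) :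
  pi_tr_odd (fun c => e c * x c) c =
  e' c *: gr_scale (fun c => (e c)^-1) (pi_tr_odd x c).
Proof.
rewrite /pi_tr_odd transE -[M in scale_mx _ _ _ *m M]submxK scale_mx_conj.
rewrite map_block_mx block_mxKur 2!mxE.
exact: gr_scaleZ.
Qed.

Lemma pi_overlap_torus :
  pi_overlap J x -> pi_overlap J (fun c => e c * x c).
Proof.
move=> xJ s; rewrite xE -map_flag_C.
rewrite (@flag_C_torus _ _ _ _ J a a a' a') //; set C := flag_C _ _ _ _.
have bs m p (M : 'M[grassmann K (pi_coord I)]_(m, p)) : map_mx (@gr_body K (pi_coord I))
    (map_mx (gr_scale (fun c => (e c)^-1)) M) = map_mx (@gr_body K _) M.
  by apply/matrixP => i j; rewrite !mxE gr_body_scale.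
rewrite bs !map_mxM !unitmx_mul [map_mx _ C \in _]xJ andbT.
have U m (b : 'I_m -> K) : (forall i, b i != 0) ->
   map_mx (@gr_body K (pi_coord I)) (scale_mx _ b b) \in unitmx.
  move=> bn; have := scale_mxK (grassmann K (pi_coord I)) bn bn.
  move/(congr1 (map_mx (@gr_body K (pi_coord I)))); rewrite map_mxM map_mx1 => h.
  exact: (mulmx1_unit h).1.
apply/andP; split; first by apply: U; apply: a'n.
by apply: U => i; rewrite invr_eq0; apply: an.
Qed.
End TwoCharts.
End PiTorus.

(** * Overlaps of charts *)

Lemma exists_nonroot (K : numFieldType) (p : {poly K}) : p != 0 ->
  exists t, p.[t] != 0.
Proof.
move=> p0; apply: contrapT => np.
pose rs : seq K := [seq i%:R | i <- iota 0 (size p)].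
have rsu : uniq rs.
  by rewrite map_inj_uniq ?iota_uniq // => i j /eqP; rewrite eqr_nat => /eqP.
have rsr : all (root p) rs.
  by apply/allP => t _; rewrite rootE; apply: contrapT => /negP pt; case: np; exists t.
by have := max_poly_roots p0 rsr rsu; rewrite size_map size_iota ltnn.
Qed.

(** [E^T] meets the first requirement and [invmx C *m E'^T] the second, so a generic member of the
    pencil through them has both minors invertible; multiplying it on the right by the inverse of
    the first minor normalises the rows selected by [e]. *)
Lemma rowsub_transversal (K : numFieldType) (m p : nat) (C : 'M[K]_m)
    (e e' : 'I_p -> 'I_m) : C \in unitmx -> injective e -> injective e' ->
  exists z : 'M[K]_(m, p),
    rowsub e z = 1%:M /\ rowsub e' (C *m z) \in unitmx.
Proof.
move=> Cu ei e'i.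
have selK (f : 'I_p -> 'I_m) : injective f ->
    rowsub f (1%:M : 'M[K]_m) *m (rowsub f (1%:M : 'M[K]_m))^T = 1%:M.
  move=> fi; apply/matrixP => i j; rewrite !mxE (bigD1 (f i)) //= big1.
    by rewrite !mxE eqxx mul1r addr0 (inj_eq fi) eq_sym.
  by move=> l li; rewrite !mxE eq_sym (negbTE li) mul0r.
pose E := rowsub e (1%:M : 'M[K]_m); pose E' := rowsub e' (1%:M : 'M[K]_m).
have rowsubE (f : 'I_p -> 'I_m) (M : 'M[K]_(m, p)) :
    rowsub f M = rowsub f 1%:M *m M.
  by rewrite mul_rowsub_mx mul1mx.
pose Z1 := invmx C *m E'^T.
(* Both minors of [E^T + t Z1] are nonzero polynomials in [t]. *)
pose P : {poly K} := \det (1%:M + 'X *: map_mx polyC (E *m Z1)) *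
  \det (map_mx polyC (E' *m C *m E^T) + 'X%:M).
(* The first factor takes the value 1 at 0; the second is a characteristic polynomial, hence
   monic. *)
have P0 : P != 0.
  rewrite mulf_neq0 //.
    apply/eqP => /(congr1 (horner_eval 0)); rewrite -det_map_mx map_mxD map_mx1.
    rewrite map_mxZ /= /horner_eval hornerX scale0r addr0 det1 horner0.
    by move/eqP; rewrite oner_eq0.
  have -> : map_mx polyC (E' *m C *m E^T) + 'X%:M =
      char_poly_mx (- (E' *m C *m E^T)).
    by rewrite /char_poly_mx map_mxN opprK addrC.
  by rewrite monic_neq0 // char_poly_monic.
have [t] := exists_nonroot P0; rewrite hornerM mulf_eq0 negb_or.
rewrite -!horner_evalE -!det_map_mx !map_mxD map_mxZ map_mx1 map_scalar_mx.
rewrite /= !horner_evalE hornerX.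
have evalC q r (M : 'M[K]_(q, r)) : map_mx (horner_eval t) (map_mx polyC M) = M.
  by apply/matrixP => i j; rewrite !mxE horner_evalE hornerC.
rewrite !evalC -!unitfE => /andP[u1 u2].
pose z := E^T + t *: Z1.
have Ez : E *m z = 1%:M + t *: (E *m Z1) by rewrite mulmxDr (selK e ei) -scalemxAr.
have Az : E' *m (C *m z) = E' *m C *m E^T + t%:M.
  rewrite mulmxDr -scalemxAr mulKVmx // mulmxDr -scalemxAr (selK e' e'i).
  by rewrite mulmxA scalemx1.
have Eu : E *m z \in unitmx by rewrite unitmxE Ez.
have Au : E' *m (C *m z) \in unitmx by rewrite unitmxE Az.
exists (z *m invmx (E *m z)); rewrite !rowsubE -/E -/E'; split.
  by rewrite mulmxA mulmxV.
by rewrite (mulmxA C) (mulmxA E') unitmx_mul Au unitmx_inv Eu.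
Qed.

Section Overlaps.
Variables (n : nat) (k : seq nat) (K : numFieldType).
Local Notation kd := (flag_dim n k).
Local Notation flag_index := (flag_index n k).
Implicit Types I J : flag_index.

Lemma idx_enum_inj I s : injective (@idx_enum n k I s).
Proof. by move=> i j /enum_val_inj/cast_ord_inj. Qed.

Lemma idx_enumP I (s : 'I_(size k)) (i : 'I_(kd s)) :
  i \in idx_set I s -> exists j, i = idx_enum I j.
Proof.
move=> iI; exists (cast_ord (idx_card I s) (enum_rank_in iI i)).
by rewrite /idx_enum cast_ordK enum_rankK_in.
Qed.

Definition double_mx (Z : forall s : 'I_(size k), 'M[K]_(kd s, kd s.+1))
  (s : 'I_(size k)) : 'M[K]_(kd s + kd s, kd s.+1 + kd s.+1) :=
  block_mx (Z s) 0 0 (Z s).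

(** The matrix C of a level depends only on the coordinate matrices above it, so these can be chosen
    level by level, each making the next minor invertible. With zero odd part and equal diagonal
    blocks the question is one about ordinary flags. *)
Lemma exists_transversal I J (m : nat) :
  exists Z : forall s : 'I_(size k), 'M[K]_(kd s, kd s.+1),
    (forall s : 'I_(size k), (s < m)%N -> rowsub (idx_enum I (s := s)) (Z s) = 1%:M) /\
    (forall s (le_s : (s <= size k)%N), (s <= m)%N -> exists2 c,
      flag_C (double_mx Z) J J le_s = block_mx c 0 0 c & c \in unitmx).
Proof.
elim: m => [|m [Z [ZI ZJ]]].
  exists (fun=> 0); split=> // -[|//] le_s _ /=.
  by exists 1%:M; rewrite ?unitmx1 // -scalar_mx_block.
have [lt_m|ge_m] := ltnP m (size k); last first.
  exists Z; split=> [s _|s le_s _]; last by apply: ZJ; apply: leq_trans ge_m.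
  by apply: ZI; apply: leq_trans ge_m.
have [c cE cu] := ZJ m (ltnW lt_m) (leqnn m).
have [z [zI zJ]] := rowsub_transversal cu
  (@idx_enum_inj I (Ordinal lt_m)) (@idx_enum_inj J (Ordinal lt_m)).
(* [conform_mx] only gives [z] a type at a variable level; at [Ordinal lt_m] it is the identity. *)
pose Z' (s : 'I_(size k)) := if s == Ordinal lt_m then conform_mx (Z s) z else Z s.
have Z'm : Z' (Ordinal lt_m) = z by rewrite /Z' eqxx conform_mx_id.
have Z'E (s : 'I_(size k)) : (s < m)%N -> Z' s = Z s.
  by move=> lt_s; rewrite /Z' -val_eqE /= ltn_eqF.
have CE s (le_s : (s <= size k)%N) : (s <= m)%N ->
    flag_C (double_mx Z') J J le_s = flag_C (double_mx Z) J J le_s.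
  move=> lesm; apply: eq_flag_C => s' lts'; rewrite /double_mx Z'E //.
  exact: leq_trans lts' lesm.
exists Z'; split=> [s|s le_s].
  rewrite ltnS leq_eqVlt => /orP[/eqP sm|ltsm]; last by rewrite Z'E ?ZI.
  by have -> : s = Ordinal lt_m; [apply/val_inj | rewrite Z'm].
rewrite leq_eqVlt => /orP[/eqP sm|]; last first.
  by rewrite ltnS => lesm; rewrite CE //; apply: ZJ.
subst s; exists (rowsub (idx_enum J (s := Ordinal lt_m)) (c *m z)) => //=.
rewrite CE // (bool_irrelevance (ltnW le_s) (ltnW lt_m)) cE.
rewrite (bool_irrelevance le_s lt_m) /double_mx Z'm.
rewrite mulmx_block !mul0mx !mulmx0 !addr0 !add0r.
rewrite (@idx_rows_block _ _ _ _ (Ordinal lt_m)).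
by congr block_mx; apply/matrixP => i j; rewrite !mxE.
Qed.

Lemma gr_body_flag_C I J (x : pi_coord I -> K) s (le_s : (s <= size k)%N) :
  map_mx (@gr_body K _) (flag_C (pi_point x) J J le_s) =
  flag_C (pi_Z x (fun=> 0)) J J le_s.
Proof.
rewrite map_flag_C; congr (flag_C _ J J le_s).
apply: functional_extensionality_dep => s'; rewrite /pi_point map_pi_Z.
congr (pi_Z _ _ s'); apply/funext => c /=.
  by rewrite gr_body_alg.
by rewrite gr_body_gen.
Qed.

Lemma pi_overlap_nonempty I J : exists x : pi_coord I -> K, pi_overlap J x.
Proof.
have [Z [ZI ZJ]] := exists_transversal I J (size k).
pose x (c : pi_coord I) : K := Z (tag (val c)) (coord_row c) (coord_col c).
have xE : pi_Z x (fun=> 0) = double_mx Z.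
  apply: functional_extensionality_dep => s.
  have b1 : pi_block 1 x s = Z s.
    apply/matrixP => i j; rewrite mxE; case: insubP => [c _ ec|].
      by rewrite /x /coord_row /coord_col ec.
    rewrite /= negbK => /idx_enumP[j' ->]; have := ZI s (ltn_ord s).
    move/matrixP/(_ j' j); rewrite !mxE => ->.
    by rewrite (inj_eq (@idx_enum_inj I s)) eq_sym; case: eqP.
  have b0 : pi_block 0 (fun _ : pi_coord I => 0 : K) s = 0.
    by apply/matrixP => i j; rewrite !mxE if_same; case: insub.
  by rewrite /pi_Z b1 b0.
exists x => s; rewrite gr_body_flag_C xE.
have [c -> cu] := ZJ _ (ltn_ord s) (ltn_ord s).
by rewrite unitmxE det_ublock unitrM -!unitmxE cu.
Qed.

(** On the line from [x] to a point of the overlap, reached at t = 1, the product of the minors is a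
    polynomial that does not vanish at 1. Hence the line leaves the overlap at finitely many
    parameters only. *)
Lemma pi_overlap_line I J (x : pi_coord I -> K) :
  exists v : pi_coord I -> K, exists2 p : {poly K}, p != 0 &
    forall t, p.[t] != 0 -> pi_overlap J (fun c => x c + t * v c).
Proof.
have [x1 x1J] := pi_overlap_nonempty I J.
pose v c := x1 c - x c.
pose X (c : pi_coord I) : {poly K} := (x c)%:P + 'X * (v c)%:P.
pose C (s : 'I_(size k)) := flag_C (pi_Z X (fun=> 0)) J J (ltn_ord s).
have CE t s : (\det (C s)).[t] =
    \det (flag_C (pi_Z (fun c => x c + t * v c) (fun=> 0)) J J (ltn_ord s)).
  rewrite -horner_evalE -det_map_mx map_flag_C; congr (\det _).
  apply: (congr1 (fun Z => flag_C Z J J (ltn_ord s))).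
  apply: functional_extensionality_dep => s'; rewrite map_pi_Z.
  congr (pi_Z _ _ s'); apply/funext => c.
    by rewrite /= horner_evalE /X !hornerE.
  by rewrite /= horner_evalE horner0.
pose p := \prod_s \det (C s).
have pE t : p.[t] != 0 -> pi_overlap J (fun c => x c + t * v c).
  rewrite horner_prod => /prodf_neq0 pt s; rewrite gr_body_flag_C.
  by rewrite unitmxE unitfE -CE; apply: pt.
exists v; exists p => //; apply/eqP => p0.
have : p.[1] != 0.
  rewrite horner_prod; apply/prodf_neq0 => s _; rewrite CE -unitfE -unitmxE.
  have -> : (fun c => x c + 1 * v c) = x1.
    by apply/funext => c; rewrite mul1r subrKC.
  by rewrite -gr_body_flag_C; apply: x1J.
by rewrite p0 horner0 eqxx.
Qed.
End Overlaps.

(** * Charts given by intervals of rows *)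

Section IntervalCharts.
Variables (n : nat) (k : seq nat).
Local Notation kd := (flag_dim n k).

Lemma val_enum_interval m p q : (p + q <= m)%N ->
  map val (enum [set i : 'I_m | (p <= i < p + q)%N]%SET) = iota p q.
Proof.
move=> le_m; pose a i := (p <= i < p + q)%N.
have -> : enum [set i : 'I_m | (p <= i < p + q)%N]%SET =
    seq.filter (preim val a) (enum 'I_m).
  rewrite enumT {1}/enum_mem; apply: eq_filter => i. by rewrite -[LHS]/(i \in _) inE.
rewrite -(seq.filter_map (@nat_of_ord m) a (enum 'I_m)) val_enum_ord.
rewrite -(subnKC le_m) !iotaD !filter_cat !add0n /a.
rewrite (eq_in_filter (a2 := pred0)); last first.
  by move=> i; rewrite mem_iota /= => /ltn_geF ->.
rewrite filter_pred0 (eq_in_filter (a2 := predT)); last first.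
  by move=> i; rewrite mem_iota => ->.
rewrite filter_predT (eq_in_filter (a2 := pred0)); last first.
  by move=> i; rewrite mem_iota => /andP[le_i _]; rewrite [RHS]/= ltnNge le_i andbF.
by rewrite filter_pred0 cats0.
Qed.

Variable o : nat -> nat.
Hypothesis o_le : forall s : 'I_(size k), (o s + kd s.+1 <= kd s)%N.

Definition interval_set (s : 'I_(size k)) : {set 'I_(kd s)} :=
  [set i : 'I_(kd s) | (o s <= i < o s + kd s.+1)%N]%SET.

Fact interval_card s : #|interval_set s| = kd s.+1.
Proof.
by rewrite cardE -(size_map val) val_enum_interval ?size_iota.
Qed.

Definition interval_chart : flag_index n k := FlagIndex interval_card.

Lemma val_idx_enum_interval (s : 'I_(size k)) (j : 'I_(kd s.+1)) :
  idx_enum interval_chart j = (o s + j)%N :> nat.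
Proof.
have jlt : (j < size (enum (interval_set s)))%N by rewrite -cardE interval_card.
have x0 : 'I_(kd s) by apply: (idx_enum interval_chart j).
rewrite /idx_enum (enum_val_nth x0) -(nth_map _ 0%N) //.
rewrite val_enum_interval // nth_iota; [by []|exact: ltn_ord j].
Qed.
End IntervalCharts.

Import numFieldNormedType.Exports.
Import Normc.
Local Open Scope complex_scope.

(** * The maximum principle *)

Section ComplexNorm.
Variable R : realType.
Local Notation C := R[i].
Implicit Types z : C.

Lemma normE_normc z : `|z| = (normc z)%:C.
Proof. by []. Qed.

Lemma normc_ge0 z : 0 <= normc z.
Proof. by case: z => a b; rewrite sqrtr_ge0. Qed.

Lemma normc_eq0 z : (normc z == 0) = (z == 0).
Proof. by apply/eqP/eqP => [/eq0_normc|->] //; rewrite normc0. Qed.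

Lemma normc_gt0 z : (0 < normc z) = (z != 0).
Proof. by rewrite lt_def normc_eq0 normc_ge0 andbT. Qed.

Lemma normcX z m : normc (z ^+ m) = normc z ^+ m.
Proof. by elim: m => [|m IHm]; rewrite ?normc1 // !exprS normcM IHm. Qed.

Lemma normc_prod (I : finType) (F : I -> C) :
  normc (\prod_i F i) = \prod_i normc (F i).
Proof. by elim/big_rec2: _ => [|i x y _ <-]; rewrite ?normc1 ?normcM. Qed.

Lemma le_normc_sum (I : finType) (P : pred I) (F : I -> C) :
  normc (\sum_(i | P i) F i) <= \sum_(i | P i) normc (F i).
Proof.
elim/big_rec2: _ => [|i x y _ le_xy]; first by rewrite normc0.
by apply: le_trans (le_normcD _ _) _; rewrite lerD2l.
Qed.

Lemma normc_real (r : R) : 0 <= r -> normc r%:C = r.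
Proof. by move=> r0; rewrite /normc /= expr0n addr0 sqrtr_sqr ger0_norm. Qed.

Lemma normc_Re z : `|complex.Re z| <= normc z.
Proof. by rewrite -lecR -normE_normc; apply: normc_ge_Re. Qed.

Lemma normc_Im z : `|complex.Im z| <= normc z.
Proof.
case: z => a b /=; rewrite -sqrtr_sqr ler_wsqrtr // lerDr sqr_ge0.
by [].
Qed.

Lemma normc_le z : normc z <= `|complex.Re z| + `|complex.Im z|.
Proof.
case: z => a b /=; rewrite -(ler_pXn2r (n := 2)) ?nnegrE ?sqrtr_ge0 ?addr_ge0 //.
rewrite sqr_sqrtr ?addr_ge0 ?sqr_ge0 // sqrrD !real_normK ?num_real //.
by rewrite lerD2r lerDl mulrn_wge0 // mulr_ge0.
Qed.

Lemma normc_dist z z' : normc z - normc z' <= normc (z - z').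
Proof. by rewrite lerBlDr -[leLHS]/(normc z) -{1}(subrK z' z) le_normcD. Qed.
End ComplexNorm.

Section Expansion.
Variable R : realType.
Local Notation C := R[i].

(* Polynomial approximation to all orders with a uniform geometric error, as
   satisfied by the sum of a convergent power series. *)
Definition expandable (g : C -> C) (t0 : C) : Prop :=
  exists delta A : R, 0 < delta /\ forall K, exists2 p : {poly C},
    (size p <= K)%N & forall t, normc t <= delta ->
      normc (g (t0 + t) - p.[t]) <= A * (normc t / delta) ^+ K.

Lemma poly_normc_bound (p : {poly C}) (M : R) :
  exists2 B, 0 <= B & forall t, normc t <= M -> normc p.[t] <= B.
Proof.
elim/poly_ind: p => [|p c [B B0 pB]].
  by exists 0 => // t _; rewrite horner0 normc0.
exists (B * `|M| + normc c); first by rewrite addr_ge0 ?mulr_ge0 ?normc_ge0.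
move=> t tM; rewrite hornerMXaddC; apply: le_trans (le_normcD _ _) _.
rewrite lerD2r normcM ler_pM ?normc_ge0 ?pB //.
by apply: le_trans tM (ler_norm M).
Qed.

Lemma le0_geometric (a A : R) : (forall K, a <= A * (1/2) ^+ K) -> a <= 0.
Proof.
move=> aA; rewrite leNgt; apply/negP => a0.
have A0 : 0 < A by have := aA 0%N; rewrite expr0 mulr1; apply: lt_le_trans.
have := aA (Num.bound (A / a)); rewrite leNgt; case/negP.
set N := Num.bound _; rewrite div1r exprVn.
have lt2N : N%:R < 2 ^+ N :> R by rewrite -natrX ltr_nat ltn_expl.
rewrite ltr_pdivrMr ?exprn_gt0 // mulrC -ltr_pdivrMr //.
apply: le_lt_trans lt2N; apply: ltW; apply: archi_boundP.
by rewrite divr_ge0 ?ltW.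
Qed.

Lemma expandableB g c t0 : expandable g t0 -> expandable (fun t => g t - c) t0.
Proof.
case=> delta [A [d0 gA]]; exists delta, (A + normc c); split=> // K.
(* At order 0 only the zero polynomial is allowed, so the constant has to be absorbed by the error
   bound. *)
have [p sp pA] := gA K; case: K sp pA => [|K] sp pA.
  exists 0; rewrite ?size_poly0 // => t td; rewrite horner0 subr0 expr0 mulr1.
  have := pA t td; rewrite expr0 mulr1.
  move: sp; rewrite leqn0 size_poly_eq0 => /eqP ->; rewrite horner0 subr0 => gtA.
  by apply: le_trans (le_normcD _ _) _; rewrite normcN lerD2r.
exists (p - c%:P) => [|t td].
  by rewrite (leq_trans (size_polyD _ _)) // size_polyN geq_max sp
       (leq_trans (size_polyC_leq1 _)).
rewrite hornerD hornerN hornerC opprB addrA subrK; apply: le_trans (pA t td) _.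
by rewrite ler_wpM2r ?exprn_ge0 ?divr_ge0 ?normc_ge0 ?lerDl ?normc_ge0 ?(ltW d0).
Qed.

Lemma expandable_continuous g t0 : expandable g t0 -> forall e : R, 0 < e ->
  exists2 eta : R, 0 < eta & forall t, normc t < eta -> normc (g (t0 + t) - g t0) < e.
Proof.
case=> delta [A [d0 gA]] e e0; have [p sp pA] := gA 1%N.
have pE : p = (g t0)%:P.
  rewrite (size1_polyC sp); congr polyC; apply/esym/eqP; rewrite -subr_eq0.
  have := pA 0; rewrite normc0 mul0r expr1 mulr0 addr0 horner_coef0.
  by rewrite -normc_eq0 eq_le normc_ge0 andbT; apply; apply: ltW.
pose B := `|A| + 1; have B0 : 0 < B by rewrite ltr_wpDl.
exists (Num.min delta (e * delta / B)) => [|t].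
  by rewrite lt_min d0 divr_gt0 ?mulr_gt0.
rewrite lt_min => /andP[td te]; have := pA t (ltW td).
rewrite pE hornerC expr1 => /le_lt_trans; apply.
apply: (@le_lt_trans _ _ (B * (normc t / delta))).
  rewrite ler_wpM2r ?divr_ge0 ?normc_ge0 ?(ltW d0) //.
  by apply: le_trans (ler_norm A) _; rewrite lerDl.
by rewrite mulrA ltr_pdivrMr // mulrC -ltr_pdivlMr.
Qed.

(* If [g - g t0] starts with a nonzero term of order [N] then its argument can
   be aligned with that of [g t0], which makes [normc g] larger than at [t0]. *)
Lemma expandable_max g t0 : expandable g t0 ->
  (forall t, normc (g t) <= normc (g t0)) ->
  exists2 delta : R, 0 < delta & forall t, normc t <= delta -> g (t0 + t) = g t0.
Proof.
move=> [delta [A [d0 gA]]] gmax.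
have [g00|g0n] := eqVneq (g t0) 0.
  exists 1 => // t _; rewrite g00; apply/eqP.
  by rewrite -normc_eq0 eq_le normc_ge0 andbT; rewrite -(normc0 R) -[0%C]g00.
(* Every approximating polynomial of positive order is the constant [g t0]; otherwise its first
   nonconstant term would contradict maximality. *)
have pE K (p : {poly C}) : (0 < K)%N -> (size p <= K)%N ->
    (forall t, normc t <= delta ->
      normc (g (t0 + t) - p.[t]) <= A * (normc t / delta) ^+ K) ->
    p = (g t0)%:P.
  move=> K0 sp pA.
  have p0 : p.[0] = g t0.
    apply/esym/eqP; rewrite -subr_eq0.
    have := pA 0; rewrite normc0 mul0r expr0n addr0 (gtn_eqF K0) mulr0.
    by rewrite -normc_eq0 eq_le normc_ge0 andbT; apply; apply: ltW.
  apply/eqP; rewrite -subr_eq0; apply/negPn/negP => pn.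
  have [N [q q0 pq]] := multiplicity_XsubC (p - (g t0)%:P) 0.
  rewrite pn /= subr0 in q0 pq.
  have N0 : (0 < N)%N.
    rewrite lt0n; apply/eqP => N0; move: pq q0; rewrite N0 expr0 mulr1 => <-.
    by rewrite rootE hornerD hornerN hornerC p0 subrr eqxx.
  have NK : (N < K)%N.
    have qn : q != 0 by apply: contraNneq q0 => ->; rewrite root0.
    have : (size (p - (g t0)%:P)%R <= K)%N.
      rewrite (leq_trans (size_polyD _ _)) // size_polyN geq_max sp.
      by rewrite (leq_trans (size_polyC_leq1 _)).
    rewrite pq size_mulXn // => /(leq_trans _); apply.
    by rewrite -[X in (X < _)%N]addn0 ltn_add2l size_poly_gt0.
  rewrite rootE in q0.
  pose u := N.-root (g t0 / q.[0]).
  have uN : u ^+ N * q.[0] = g t0 by rewrite rootCK // divfK.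
  pose U := normc u.
  have U0 : 0 <= U by apply: normc_ge0.
  have [r rE] : exists r, q = q.[0]%:P + r * 'X.
    have /factor_theorem[r rE] : root (q - q.[0]%:P) 0.
      by rewrite rootE hornerD hornerN hornerC subrr.
    by exists r; rewrite -['X]subr0 -rE addrC subrK.
  have [B B0 rB] := poly_normc_bound r U.
  pose D := U ^+ N * (B * U) + `|A| * (U / delta) ^+ K.
  have D0 : 0 <= D.
    rewrite addr_ge0 ?mulr_ge0 ?exprn_ge0 //.
    by rewrite divr_ge0 // ltW.
  (* At t = e u the aligned term contributes e^N [g t0]. Maximality bounds it by the other terms of
     [p] and the approximation error, both of order e^(N+1) because N < K; [D] collects their
     constants after division by e^(N+1). *)
  have key (e : R) : 0 < e -> e <= 1 -> e * U <= delta -> normc (g t0) <= e * D.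
    move=> e0 e1 eU.
    set t := e%:C * u.
    have nt : normc t = e * U by rewrite normcM normc_real ?ltW.
    have ptE : p.[t] = (1 + e ^+ N)%:C * g t0 + e%:C ^+ N * u ^+ N * (r.[t] * t).
      have -> : p = (g t0)%:P + q * 'X^N by rewrite -pq addrC subrK.
      rewrite {1}rE !hornerE rmorphD rmorphXn rmorph1 /= exprMn.
      rewrite -uN; ring.
    have gt : normc ((1 + e ^+ N)%:C * g t0) <=
        normc (g t0) + e ^+ N * (U ^+ N * (B * (e * U))) + `|A| * (e * (U / delta)) ^+ K.
      have -> : (1 + e ^+ N)%:C * g t0 = g (t0 + t) -
          e%:C ^+ N * u ^+ N * (r.[t] * t) - (g (t0 + t) - p.[t]).
        rewrite ptE; ring.
      apply: le_trans (le_normcD _ _) _; rewrite normcN lerD //.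
        apply: le_trans (le_normcD _ _) _; rewrite normcN lerD //.
        rewrite normcM [X in X * _]normcM [X in _ * X]normcM nt !normcX.
        rewrite normc_real ?(ltW e0) // -mulrA ler_wpM2l ?exprn_ge0 ?(ltW e0) //.
        rewrite ler_wpM2l ?exprn_ge0 // ler_wpM2r ?mulr_ge0 ?(ltW e0) //.
        by apply: rB; rewrite nt ler_piMl.
      rewrite mulrA -nt; apply: le_trans (pA t _) _; first by rewrite nt.
      by rewrite ler_wpM2r ?ler_norm // exprn_ge0 ?divr_ge0 ?normc_ge0 ?(ltW d0).
    rewrite normcM normc_real ?addr_ge0 ?exprn_ge0 ?(ltW e0) // in gt.
    rewrite mulrDl mul1r -addrA lerD2l in gt.
    have eN0 : 0 < e ^+ N by rewrite exprn_gt0.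
    rewrite -(ler_pM2l eN0); apply: le_trans gt _.
    have eK : e ^+ K <= e ^+ N * e.
      by rewrite -exprSr ler_wiXn2l ?(ltW e0).
    rewrite exprMn [X in _ + X]mulrCA /D.
    apply: (@le_trans _ _ (e ^+ N * (U ^+ N * (B * (e * U))) +
       e ^+ N * e * (`|A| * (U / delta) ^+ K))).
      rewrite lerD2l ler_wpM2r // mulr_ge0 // exprn_ge0 // divr_ge0 //.
      exact: ltW.
    by rewrite le_eqVlt; apply/orP; left; apply/eqP; ring.
  have gp : 0 < normc (g t0) by rewrite normc_gt0.
  (* The second bound keeps e u in the disc; the third makes e D smaller than [normc (g t0)],
     against [key]. *)
  pose e := Num.min 1 (Num.min (delta / (U + 1)) (normc (g t0) / (D + D + 1))).
  have U1 : 0 < U + 1 by rewrite ltr_wpDl.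
  have D1 : 0 < D + D + 1 by rewrite ltr_wpDl // addr_ge0.
  have e0 : 0 < e by rewrite !lt_min ltr01 !divr_gt0.
  have eU : e <= delta / (U + 1) by rewrite /e !ge_min lexx orbT.
  have eD : e <= normc (g t0) / (D + D + 1) by rewrite /e !ge_min lexx !orbT.
  have e1 : e <= 1 by rewrite /e !ge_min lexx.
  rewrite ler_pdivlMr // in eU; rewrite ler_pdivlMr // in eD.
  have : normc (g t0) <= e * D.
    by apply: key => //; move: eU; rewrite mulrDr mulr1; lra.
  by nra.
(* On the half disc the error bound tends to 0 as the order grows, while the approximating
   polynomial stays [g t0]. *)
exists (delta / 2) => [|t td]; first by rewrite divr_gt0.
apply/eqP; rewrite -subr_eq0 -normc_eq0 eq_le normc_ge0 andbT.
apply: (@le0_geometric _ `|A|) => K.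
have [p sp pA] := gA K.+1.
have td' : normc t <= delta by apply: le_trans td _; lra.
have := pA t td'; rewrite (pE K.+1 p) // hornerC => /le_trans; apply.
have x0 : 0 <= normc t / delta by rewrite divr_ge0 ?normc_ge0 ?(ltW d0).
have x1 : normc t / delta <= 1 / 2 by rewrite ler_pdivrMr // mulrC mul1r.
apply: (@le_trans _ _ (`|A| * (normc t / delta) ^+ K.+1)).
  by rewrite ler_wpM2r ?exprn_ge0 ?ler_norm.
rewrite ler_wpM2l // exprS.
apply: (@le_trans _ _ (1 * (normc t / delta) ^+ K)).
  by rewrite ler_wpM2r ?exprn_ge0 //; lra.
by rewrite mul1r lerXn2r ?nnegrE.
Qed.
End Expansion.

Section Vanishing.
Variable R : realType.
Local Notation C := R[i].

Lemma expandable_normc_continuous (g : C -> C) : (forall t, expandable g t) ->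
  continuous (fun z : R * R => normc (g (z.1 +i* z.2))).
Proof.
move=> gE z; apply/cvgrPdist_lt => e e0.
have [eta eta0 etaE] := expandable_continuous (gE (z.1 +i* z.2)) e0.
have : \forall w \near z, `|z.1 - w.1| < eta / 2 /\ `|z.2 - w.2| < eta / 2.
  exists (ball z.1 (eta / 2), ball z.2 (eta / 2)) => /=.
    by split; apply: nbhsx_ballx; rewrite divr_gt0.
  by move=> [w1 w2] [].
apply: filterS => w [w1 w2].
have wE : w.1 +i* w.2 = (z.1 +i* z.2) + ((w.1 - z.1) +i* (w.2 - z.2)).
  by apply/eqP; rewrite eq_complex /= !subrKC !eqxx.
rewrite wE; set t := (w.1 - z.1) +i* _.
have tE : normc t < eta.
  apply: le_lt_trans (normc_le t) _; rewrite /= distrC (distrC w.2).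
  by rewrite [eta]splitr ltrD.
have := etaE t tE; set a := g _; set b := g _ => ab.
rewrite ltr_norml; apply/andP; split.
  rewrite ltrNl opprB; apply: le_lt_trans ab; exact: normc_dist.
have ba : normc (b - a) < e by rewrite -opprB normcN.
by apply: le_lt_trans ba; apply: normc_dist.
Qed.

(** If g were nonzero, decay and compactness would give a point b where [normc g] has a positive
    global maximum. On the ray b + u, u >= 0, the set where this maximum is attained is bounded by
    decay, contains its supremum by continuity, and extends beyond it by [expandable_max]. *)
Lemma expandable_vanishing (g : C -> C) : (forall t, expandable g t) ->
  (forall e : R, 0 < e -> exists M : R, forall t, M <= normc t -> normc (g t) <= e) ->
  forall t, g t = 0.
Proof.
move=> gE g_oo a; apply/eqP/negPn/negP => ga.
have ga0 : 0 < normc (g a) by rewrite normc_gt0.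
have [M0 M0P] := g_oo (normc (g a) / 2) (divr_gt0 ga0 (ltr0n _ 2)).
pose M := `|M0| + normc a + 1.
have M0M : M0 <= M.
  by have := ler_norm M0; have := normc_ge0 a; rewrite /M; lra.
have MP t : M <= normc t -> normc (g t) < normc (g a).
  move=> /(le_trans M0M)/M0P/le_lt_trans; apply; lra.
have aM : normc a < M.
  by rewrite ltNge; apply/negP => /MP; rewrite ltxx.
pose box : set (R * R) := `[- M, M] `*` `[- M, M].
have inbox t : normc t <= M -> box (complex.Re t, complex.Im t).
  move=> tM; split; rewrite /= in_itv /= -ler_norml.
    exact: le_trans (normc_Re t) tM.
  exact: le_trans (normc_Im t) tM.
pose h (z : R * R) := normc (g (z.1 +i* z.2)).
have hE t : h (complex.Re t, complex.Im t) = normc (g t) by rewrite /h; case: t.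
have [z zbox zmax] : exists2 z, z \in box & forall w, w \in box -> h w <= h z.
  apply: compact_EVT_max.
  - by exists (complex.Re a, complex.Im a); apply/inbox/ltW.
  - by apply: compact_setX; apply: segment_compact.
  - exact/continuous_subspaceT/expandable_normc_continuous.
set b := z.1 +i* z.2; pose m := normc (g b).
have boxP t : normc t <= M -> normc (g t) <= m.
  by move=> tM; rewrite -hE; apply: zmax; rewrite inE; apply: inbox.
have am : normc (g a) <= m by apply/boxP/ltW.
have maxP t : normc (g t) <= m.
  have [/boxP//|/ltW/MP/ltW gta] := leP (normc t) M.
  exact: le_trans gta am.
have m0 : 0 < m by apply: lt_le_trans ga0 (maxP a).
pose S : set R := [set u | 0 <= u /\ normc (g (b + u%:C)) = m].
have S0 : S 0 by split=> //; rewrite rmorph0 addr0.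
have Sub : ubound S (M + normc b).
  move=> u [u0 uE]; rewrite leNgt; apply/negP => uM.
  have : M <= normc (b + u%:C).
    have h1 : u - normc b <= normc (b + u%:C).
      have := normc_dist u%:C (- b); rewrite normc_real // normcN opprK.
      by rewrite [u%:C + b]addrC.
    by lra.
  by move/MP; rewrite uE ltNge maxP.
have Ssup : has_sup S by split; [exists 0 | exists (M + normc b)].
pose s := sup S.
have s0 : 0 <= s by apply: ub_le_sup => //; exists (M + normc b).
have sS : normc (g (b + s%:C)) = m.
  apply/eqP; rewrite eq_le maxP /=; apply/ler_addgt0Pr => e e0; rewrite -lerBlDl.
  have [eta eta0 etaE] := expandable_continuous (gE (b + s%:C)) e0.
  have [u uS us] := sup_adherent eta0 Ssup.
  have us' : u <= s by apply: ub_le_sup => //; exists (M + normc b).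
  have := etaE (u%:C - s%:C).
  have -> : b + s%:C + (u%:C - s%:C) = b + u%:C by rewrite -addrA subrKC.
  have -> : normc (u%:C - s%:C) = s - u.
    by rewrite -rmorphB -opprB rmorphN normcN normc_real // subr_ge0.
  have [_ uE] := uS; have us2 : s - u < eta by rewrite -/s in us; lra.
  move=> /(_ us2)/ltW; apply: le_trans.
  by apply: le_trans (normc_dist _ _); rewrite uE.
have [delta d0 dE] : exists2 delta : R, 0 < delta &
    forall t, normc t <= delta -> g (b + s%:C + t) = g (b + s%:C).
  by apply: expandable_max => // t; rewrite sS.
have : S (s + delta).
  split; first by rewrite addr_ge0 // ltW.
  by rewrite rmorphD addrA dE ?sS // normc_real // ltW.
move/(ub_le_sup (ex_intro _ _ Sub)); rewrite -/s; lra.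
Qed.
End Vanishing.

(** * Restriction of analytic functions to complex lines *)

Section Lines.
Variable R : realType.
Local Notation C := R[i].

(** A multi-index of degree below K has all its entries below K, so every box of side at least K
    contains it. *)
Lemma sum_low_degree (E : finType) (V : nmodType) (F : (E -> nat) -> V) K B :
  (K <= B)%N ->
  \sum_(m : {ffun E -> 'I_B} | (\sum_i m i < K)%N) F (fun i => m i) =
  \sum_(m : {ffun E -> 'I_K} | (\sum_i m i < K)%N) F (fun i => m i).
Proof.
case: K => [|K] leKB; first by rewrite !big_pred0.
pose w (m : {ffun E -> 'I_K.+1}) : {ffun E -> 'I_B} := [ffun i => widen_ord leKB (m i)].
rewrite (reindex_onto w (fun m => [ffun i => inord (m i)])) /=.
  apply: eq_big => m; last first.
    by move=> _; congr F; apply/funext => i; rewrite /w ffunE.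
  have -> : [ffun i => inord (w m i)] = m.
    by apply/ffunP => i; rewrite /w !ffunE; apply/val_inj; rewrite /= inordK.
  by rewrite eqxx andbT; congr (_ < _)%N; apply: eq_bigr => i _; rewrite /w ffunE.
move=> m mK; apply/ffunP => i; rewrite /w !ffunE; apply/val_inj; rewrite /= inordK //.
by apply: leq_ltn_trans mK; rewrite (bigD1 i) //= leq_addr.
Qed.

Lemma sum_geometric_box (E : finType) (B : nat) :
  \sum_(m : {ffun E -> 'I_B}) (1 / 2 : R) ^+ (\sum_i m i)%N <= 2 ^+ #|E|.
Proof.
have -> : \sum_(m : {ffun E -> 'I_B}) (1 / 2 : R) ^+ (\sum_i m i)%N =
    \prod_(i : E) \sum_(j < B) (1 / 2) ^+ j.
  rewrite bigA_distr_bigA; apply: eq_bigr => m _.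
  by rewrite prodrXr.
rewrite -prodr_const; apply: ler_prod => i _.
have geo : \sum_(j < B) (1 / 2 : R) ^+ j = 2 - 2 * (1 / 2) ^+ B.
  elim: B => [|B IHB]; first by rewrite big_ord0 expr0; lra.
  by rewrite big_ord_recr /= IHB exprS; lra.
rewrite {2}geo sumr_ge0 => [/=|j _]; last by rewrite exprn_ge0.
by rewrite lerBlDr lerDl mulr_ge0 // exprn_ge0.
Qed.

Lemma analytic_expandable (E : finType) (f : (E -> C) -> C) (a v : E -> C) :
  analytic_at f a -> expandable (fun t => f (fun i => a i + t * v i)) 0.
Proof.
case=> c [r [M [r0 cM cf]]].
have [rho rE] : exists rho : R, r = rho%:C.
  by exists (complex.Re r); rewrite RRe_real // gtr0_real.
have rho0 : 0 < rho by move: r0; rewrite rE ltcR.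
have M0 : 0 <= M.
  by apply: le_trans (cM (fun=> 0%N)); rewrite mulr_ge0 // exprn_ge0 // ltW.
have [mu ME] : exists mu : R, M = mu%:C.
  by exists (complex.Re M); rewrite RRe_real // ger0_real.
have mu0 : 0 <= mu by move: M0; rewrite ME lecR.
have cmu m : normc (c m) * rho ^+ (\sum_i m i)%N <= mu.
  by have := cM m; rewrite rE ME normE_normc -rmorphXn -rmorphM lecR.
pose V := 1 + \sum_i normc (v i).
have vV i : normc (v i) <= V.
  rewrite /V (bigD1 i) //= addrCA lerDl addr_ge0 // sumr_ge0 // => j _.
  exact: normc_ge0.
have V0 : 0 < V by rewrite ltr_pwDl // sumr_ge0 // => j _; apply: normc_ge0.
(* The 2 leaves a factor 1/2 per degree, so the tail of the series is dominated by a product of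
   [#|E|] geometric series of sum at most 2; hence the constant [2 ^+ #|E|]. *)
pose delta := rho / (2 * V).
have d0 : 0 < delta by rewrite divr_gt0 ?mulr_gt0.
exists delta, (mu * 2 ^+ #|E|); split=> // K.
pose p : {poly C} := \sum_(m : {ffun E -> 'I_K} | (\sum_i m i < K)%N)
   (c (fun i => m i) * \prod_i v i ^+ m i) *: 'X^(\sum_i m i)%N.
exists p => [|t td].
  apply: (leq_trans (size_sum _ _ _)); apply/bigmax_leqP => m mK.
  by apply: leq_trans (size_scale_leq _ _) _; rewrite size_polyXn.
pose term (m : E -> nat) := c m * \prod_i (t * v i) ^+ m i.
pose S B := \sum_(m : {ffun E -> 'I_B}) term (fun i => m i).
have tv i : `|t * v i| < r.
  rewrite normE_normc rE ltcR normcM.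
  apply: (@le_lt_trans _ _ (delta * V)).
    by rewrite ler_pM ?normc_ge0.
  rewrite /delta; have -> : rho / (2 * V) * V = rho / 2.
    by field; rewrite gt_eqF.
  by lra.
have /cvgrPdist_lt Scvg := cf _ tv.
set x := normc t / delta.
have x0 : 0 <= x by rewrite divr_ge0 ?normc_ge0 ?(ltW d0).
have x1 : x <= 1 by rewrite ler_pdivrMr // mul1r.
have pE : p.[t] = \sum_(m : {ffun E -> 'I_K} | (\sum_i m i < K)%N) term (fun i => m i).
  rewrite horner_sum; apply: eq_bigr => m _; rewrite hornerZ hornerXn /term -mulrA.
  congr (_ * _); rewrite mulrC -prodrXr -big_split /=; apply: eq_bigr => i _.
  by rewrite exprMn.
have termE (m : E -> nat) : normc (term m) <= mu * (x * (1 / 2)) ^+ (\sum_i m i)%N.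
  rewrite normcM normc_prod.
  have h : \prod_i normc ((t * v i) ^+ m i) <= (rho * (x * (1/2))) ^+ (\sum_i m i)%N.
    rewrite -prodrXr; apply: ler_prod => i _; rewrite normc_ge0 normcX /=.
    apply: lerXn2r; rewrite ?nnegrE ?normc_ge0 //.
      by rewrite mulr_ge0 ?(ltW rho0) // mulr_ge0 // divr_ge0.
    have -> : rho * (x * (1 / 2)) = normc t * V.
      by rewrite /x /delta; field; rewrite !gt_eqF.
    by rewrite normcM ler_wpM2l ?normc_ge0.
  apply: le_trans (ler_wpM2l (normc_ge0 _) h) _.
  by rewrite [(rho * _) ^+ _]exprMn mulrA ler_wpM2r ?cmu // exprn_ge0 // mulr_ge0 // divr_ge0.
have SB B : (K <= B)%N -> normc (S B - p.[t]) <= mu * 2 ^+ #|E| * x ^+ K.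
  move=> leKB; rewrite pE -(sum_low_degree term leKB) /S.
  rewrite (bigID (fun m : {ffun E -> 'I_B} => (\sum_i m i < K)%N)) /= addrAC subrr add0r.
  apply: le_trans (le_normc_sum _ _) _.
  apply: (@le_trans _ _ (\sum_(m : {ffun E -> 'I_B})
      mu * x ^+ K * (1 / 2) ^+ (\sum_i m i)%N)).
    rewrite big_mkcond /=; apply: ler_sum => m _; case: ifP => [|_]; last first.
      by rewrite !mulr_ge0 ?exprn_ge0.
    rewrite -leqNgt => mK; apply: le_trans (termE _) _.
    rewrite -mulrA ler_wpM2l // exprMn ler_wpM2r ?exprn_ge0 //.
    exact: ler_wiXn2l.
  rewrite -mulr_sumr [leRHS]mulrAC ler_wpM2l ?mulr_ge0 ?exprn_ge0 //.
  exact: sum_geometric_box.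
rewrite add0r; apply/ler_addgt0Pr => e e0.
have [B [leKB Be]] : exists B, (K <= B)%N /\
    normc (f (fun i => a i + t * v i) - S B) < e.
  have e0' : 0 < e%:C by rewrite ltcR.
  have [N _ NP] := Scvg _ e0'.
  exists (maxn K N); split; first exact: leq_maxl.
  by rewrite -ltcR; apply: (NP (maxn K N)); apply: leq_maxr.
rewrite -[f _](subrK (S B)) -addrA addrC.
by apply: le_trans (le_normcD _ _) _; rewrite lerD ?SB ?ltW.
Qed.

Lemma line_expandable (E : finType) (f : (E -> C) -> C) (a v : E -> C) t0 :
  (forall x, analytic_at f x) -> expandable (fun t => f (fun i => a i + t * v i)) t0.
Proof.
move=> fa; have := @analytic_expandable _ f (fun i => a i + t0 * v i) v (fa _).
case=> delta [A [d0 H]]; exists delta, A; split=> // K.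
have [p sp pP] := H K; exists p => // t td; have := pP t td.
congr (normc (f _ - _) <= _); apply/funext => i.
by rewrite add0r mulrDl addrA.
Qed.
End Lines.

(** * Continuity at 0 and limits at infinity *)

Section Continuity0.
Variable R : realType.
Local Notation C := R[i].

Definition continuous0 (h : C -> C) : Prop := forall e : R, 0 < e ->
  exists2 eta : R, 0 < eta & forall t, normc t < eta -> normc (h t - h 0) < e.

Lemma continuous0_cst c : continuous0 (fun=> c).
Proof. by move=> e e0; exists 1 => // t _; rewrite subrr normc0. Qed.

Lemma continuous0_id : continuous0 id.
Proof. by move=> e e0; exists e => // t; rewrite subr0. Qed.

Lemma expandable_continuous0 h : expandable h 0 -> continuous0 h.
Proof.
move=> hE e e0; have [eta eta0 etaP] := expandable_continuous hE e0.
by exists eta => // t /etaP; rewrite add0r.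
Qed.

Lemma continuous0D h1 h2 : continuous0 h1 -> continuous0 h2 ->
  continuous0 (fun t => h1 t + h2 t).
Proof.
move=> c1 c2 e e0; have e2 : 0 < e / 2 by rewrite divr_gt0.
have [eta1 p1 h1P] := c1 _ e2; have [eta2 p2 h2P] := c2 _ e2.
exists (Num.min eta1 eta2) => [|t]; first by rewrite lt_min p1.
rewrite lt_min => /andP[t1 t2]; rewrite opprD addrACA.
apply: le_lt_trans (le_normcD _ _) _; rewrite [e]splitr.
by apply: ltrD; [apply: h1P | apply: h2P].
Qed.

Lemma continuous0M h1 h2 : continuous0 h1 -> continuous0 h2 ->
  continuous0 (fun t => h1 t * h2 t).
Proof.
move=> c1 c2 e e0.
pose a := normc (h1 0) + normc (h2 0) + 1.
have a0 : 0 < a by rewrite ltr_wpDl // addr_ge0 // normc_ge0.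
pose d := Num.min 1 (e / (2 * a)).
have d0 : 0 < d by rewrite lt_min ltr01 divr_gt0 // mulr_gt0.
have [eta1 p1 h1P] := c1 _ d0; have [eta2 p2 h2P] := c2 _ d0.
exists (Num.min eta1 eta2) => [|t]; first by rewrite lt_min p1.
rewrite lt_min => /andP[/h1P t1 /h2P t2].
have -> : h1 t * h2 t - h1 0 * h2 0 =
  (h1 t - h1 0) * (h2 t - h2 0) + (h1 0 * (h2 t - h2 0) + (h1 t - h1 0) * h2 0).
  by ring.
apply: le_lt_trans (le_normcD _ _) _.
apply: le_lt_trans (_ : _ <= d * d + (normc (h1 0) * d + d * normc (h2 0))) _.
  apply: lerD; first by rewrite normcM ler_pM ?normc_ge0 ?ltW.
  apply: le_trans (le_normcD _ _) _.
  by rewrite !normcM lerD // ?ler_wpM2l ?ler_wpM2r ?normc_ge0 ?ltW.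
have d1 : d <= 1 by rewrite ge_min lexx.
have de : d <= e / (2 * a) by rewrite ge_min lexx orbT.
rewrite ler_pdivlMr ?mulr_gt0 // in de.
apply: le_lt_trans (_ : _ <= d * a) _.
  rewrite /a; have : d * d <= d by rewrite ler_piMl // ltW.
  by lra.
by nra.
Qed.

Lemma continuous0_sum (I : finType) (P : pred I) (h : I -> C -> C) :
  (forall i, P i -> continuous0 (h i)) ->
  continuous0 (fun t => \sum_(i | P i) h i t).
Proof.
move=> hc; rewrite (_ : (fun _ => _) = (\sum_(i | P i) (fun t => h i t))).
  elim/big_ind: _ => [|f g fc gc|i Pi]; first exact: continuous0_cst.
    exact: continuous0D.
  exact: hc.
by apply/funext => t; rewrite fct_sumE.
Qed.

Lemma continuous0_prod (I : finType) (P : pred I) (h : I -> C -> C) :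
  (forall i, P i -> continuous0 (h i)) ->
  continuous0 (fun t => \prod_(i | P i) h i t).
Proof.
move=> hc; rewrite (_ : (fun _ => _) = (\prod_(i | P i) (fun t => h i t))).
  elim/big_ind: _ => [|f g fc gc|i Pi]; first exact: continuous0_cst.
    exact: continuous0M.
  exact: hc.
by apply/funext => t; rewrite fct_prodE.
Qed.

(** A form of Liouville's theorem: continuity of h at 0 says that g tends to [h 0] at infinity, so
    the difference vanishes by the maximum principle. *)
Lemma expandable_inv_const (g h : C -> C) :
  (forall t, expandable g t) -> continuous0 h ->
  (forall t, t != 0 -> g t = h t^-1) -> forall t, g t = h 0.
Proof.
move=> gE hc gh t; apply/eqP; rewrite -subr_eq0; apply/eqP.
apply: (@expandable_vanishing R (fun t => g t - h 0)) => [s|e e0].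
  exact: expandableB.
have [eta eta0 hP] := hc e e0; exists (eta^-1 + 1) => s sM.
have iv : 0 < eta^-1 by rewrite invr_gt0.
have s0 : 0 < normc s by apply: lt_le_trans sM; rewrite addr_gt0.
have sn : s != 0 by rewrite -normc_gt0.
rewrite gh //; apply/ltW/hP; rewrite normcV invf_plt ?posrE //.
by apply: lt_le_trans sM; rewrite ltrDl.
Qed.

Lemma exists_small_nonroot (p : {poly C}) (eta : R) : p != 0 -> 0 < eta ->
  exists2 t, normc t < eta & p.[t] != 0.
Proof.
move=> p0 eta0; apply: contrapT => np.
pose rs : seq C := [seq (eta / i.+2%:R)%:C | i <- iota 0 (size p)].
have rsu : uniq rs.
  rewrite map_inj_uniq ?iota_uniq // => i j [] /(mulfI (lt0r_neq0 eta0)) /invr_inj.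
  by move/eqP; rewrite eqr_nat => /eqP[].
have rsr : all (root p) rs.
  apply/allP => _ /mapP[i _ ->]; rewrite rootE; apply: contrapT => /negP pt.
  case: np; exists (eta / i.+2%:R)%:C => //.
  by rewrite normc_real ?divr_ge0 ?(ltW eta0) // ltr_pdivrMr // ltr_pMr // ltr1n.
by have := max_poly_roots p0 rsr rsu; rewrite size_map size_iota ltnn.
Qed.
End Continuity0.

(** * Global sections *)

Section Sections.
Variables (R : realType) (n : nat) (k : seq nat).
Local Notation C := R[i].
Local Notation kd := (flag_dim n k).
Local Notation flag_index := (flag_index n k).
Local Notation X := (pi_flag n k C).
Implicit Types I J : flag_index.

(** By [pi_overlap_line] some line through x meets the overlap at arbitrarily small parameters, so
    continuity along lines is enough. *)
Lemma pi_overlap_dense I J (g1 g2 : (pi_coord I -> C) -> C) :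
  (forall x v, continuous0 (fun t => g1 (fun c => x c + t * v c))) ->
  (forall x v, continuous0 (fun t => g2 (fun c => x c + t * v c))) ->
  (forall x, pi_overlap J x -> g1 x = g2 x) -> g1 =1 g2.
Proof.
move=> c1 c2 g12 x; have [v [p p0 pJ]] := pi_overlap_line J x.
pose h t := g1 (fun c => x c + t * v c) - g2 (fun c => x c + t * v c).
have x0 : (fun c => x c + 0 * v c) = x by apply/funext => c; rewrite mul0r addr0.
have hc : continuous0 h.
  rewrite (_ : h = fun t => g1 (fun c => x c + t * v c) +
     (-1) * g2 (fun c => x c + t * v c)); last first.
    by apply/funext => t; rewrite mulN1r.
  by apply: continuous0D => //; apply: continuous0M => //; apply: continuous0_cst.
suff : h 0 = 0 by rewrite /h x0 => /eqP; rewrite subr_eq0 => /eqP.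
apply/eqP/negPn/negP => hn; have h0 : 0 < normc (h 0) by rewrite normc_gt0.
have [eta eta0 hP] := hc _ h0.
have [t te pt] := exists_small_nonroot p0 eta0.
have := hP t te; rewrite {1}/h g12; last exact: pJ.
by rewrite subrr sub0r normcN ltxx.
Qed.

Variable f : cochain X.
Arguments f : clear implicits.
Hypothesis fH0 : H0 X f.

Lemma section_analytic I A (x : pi_coord I -> C) : analytic_at (fun x => f I x A) x.
Proof. by case: fH0 => fa _; apply: fa. Qed.

Lemma section_line I A (x v : pi_coord I -> C) t0 :
  expandable (fun t => f I (fun c => x c + t * v c) A) t0.
Proof.
apply: (@line_expandable R _ (fun x => f I x A)) => y; exact: section_analytic.
Qed.

Lemma section_line0 I A (x v : pi_coord I -> C) :
  continuous0 (fun t => f I (fun c => x c + t * v c) A).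
Proof. by apply: expandable_continuous0; apply: section_line. Qed.

Lemma section_transition I J (x : pi_coord I -> C) : pi_overlap J x ->
  f I x = superfun_eval (f J) (pi_tr_even (J := J) x) (pi_tr_odd (J := J) x).
Proof. by case: fH0 => _ H xJ; apply: (H I J x). Qed.

Lemma cst_modW p q (c : C) I : (q <= p)%N -> cst_mod p c (f I) -> cst_mod q c (f I).
Proof. by move=> qp fp B x Bq; apply: fp; apply: leq_trans Bq qp. Qed.

(** In each degree below p the transition involves only coefficients of [f I] of the same degree,
    which are already known constants; density of the overlap does the rest. *)
Lemma cst_mod_chart p (c : C) I J : cst_mod p c (f I) -> cst_mod p c (f J).
Proof.
move=> fI A x Ap; move: x.
apply: (@pi_overlap_dense J I (fun x => f J x A) (fun=> (A == finset.set0)%:R * c)).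
- by move=> x v; apply: section_line0.
- by move=> x v; apply: continuous0_cst.
move=> x xI; rewrite (section_transition xI).
rewrite (superfun_eval_lowest _ (c := c) (p := #|A|)) //; last first.
- by apply: cst_modW fI; apply: ltnW.
- by move=> j; apply: gr_body_tr_odd.
have [A0|An] := eqVneq A finset.set0; last first.
  rewrite mul0r big1 // => B BA; rewrite fI ?(eqP BA) //.
  have /negbTE -> : B != finset.set0 by rewrite -cards_eq0 (eqP BA) cards_eq0.
  by rewrite !mul0r.
rewrite A0 cards0 (big_pred1 finset.set0) => [|B]; last by rewrite cards_eq0.
rewrite fI ?cards0; last by move: Ap; rewrite A0 cards0.
by rewrite finset.big_set0 gr1 !eqxx mulr1.
Qed.

Section TorusLimit.
Variables (I J : flag_index).
Variables (a a' : C -> forall s, 'I_(kd s) -> C).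
Arguments a : clear implicits.
Arguments a' : clear implicits.
Variables (sel : pred (pi_coord I)) (sel' : pred (pi_coord J)).
Hypothesis an : forall t, t != 0 -> forall s i, a t s i != 0.
Hypothesis a'n : forall t, t != 0 -> forall s i, a' t s i != 0.
Hypothesis Ia : forall t, torus_rows I (a t).
Hypothesis Ja' : forall t, torus_rows J (a' t).
Hypothesis a'0 : forall t, a' t 0%N =1 a t 0%N.
Hypothesis selE : forall t c, t != 0 ->
  @torus_weight _ _ _ I (a t) c = if sel c then t else 1.
Hypothesis sel'E : forall t c, t != 0 ->
  @torus_weight _ _ _ J (a' t) c = if sel' c then t^-1 else 1.

(* The one-parameter subgroup scales the coordinates selected by [sel] by [t] in
   the chart I, and those selected by [sel'] by [t^-1] in the chart J; hence the
   coefficients of a section are bounded along its orbits as t tends to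
   infinity. *)
Lemma section_torus p (c : C) (A : {set pi_coord I}) (x : pi_coord I -> C) :
  cst_mod p c (f J) -> #|A| = p -> pi_overlap J x ->
  exists h : C -> C, [/\ continuous0 h,
    forall t, f I (fun c => (if sel c then t else 1) * x c) A = h 0 &
    h 0 = (\prod_(c in A) if sel c then 0 else 1) * h 0].
Proof.
move=> fJ Ap xJ.
pose y (c : pi_coord J) := gr_body (pi_tr_even x c).
pose eta (B : {set pi_coord J}) :=
  (\prod_(j in B) pi_tr_odd x j) A.
(* Here s stands for 1/t. The three factors come from the even coordinates of [J], from its odd
   coordinates, and from the rescaling of the generators in [A]. *)
pose h (s : C) := \sum_(B : {set pi_coord J} | #|B| == p)
  f J (fun c => (if sel' c then s else 1) * y c) B *
  ((\prod_(j in B) if sel' j then s else 1) *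
   ((\prod_(c in A) if sel c then s else 1) * eta B)).
have lineE (H : flag_index) (sl : pred (pi_coord H)) (z : pi_coord H -> C) t :
    (fun c => (if sl c then t else 1) * z c) =
    fun c => (if sl c then 0 else z c) + t * (if sl c then z c else 0).
  apply/funext => c'; case: (sl c'); first by rewrite add0r.
  by rewrite mul1r mulr0 addr0.
have hc : continuous0 h.
  apply: continuous0_sum => B _; apply: continuous0M.
    rewrite (_ : (fun _ => _) = fun t => f J (fun c => (if sel' c then 0 else y c) +
       t * (if sel' c then y c else 0)) B); last by apply/funext => t; rewrite lineE.
    exact: section_line0.
  apply: continuous0M.
    apply: continuous0_prod => j _; case: (sel' j); first exact: continuous0_id.
    exact: continuous0_cst.
  apply: continuous0M; last exact: continuous0_cst.
  apply: continuous0_prod => j _; case: (sel j); first exact: continuous0_id.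
  exact: continuous0_cst.
(* At s = 0 the product over [A] is 0 or 1, hence idempotent, and can be split off once more. *)
exists h; split=> //; last first.
  rewrite /h mulr_sumr; apply: eq_bigr => B _.
  have PP : (\prod_(c in A) if sel c then 0 else 1 : C) *
      (\prod_(c in A) if sel c then 0 else 1) =
      (\prod_(c in A) if sel c then 0 else 1).
    by rewrite -big_split /=; apply: eq_bigr => i _; case: (sel i); rewrite ?mulr0 ?mulr1.
  by rewrite -{1}PP; ring.
apply: expandable_inv_const => // [t|t t0].
  rewrite (_ : (fun _ => _) = fun t => f I (fun c => (if sel c then 0 else x c) +
       t * (if sel c then x c else 0)) A); last by apply/funext => u; rewrite lineE.
  exact: section_line.
have eE : (fun c => (if sel c then t else 1) * x c) =
    fun c => torus_weight (a t) c * x c.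
  by apply/funext => c'; rewrite selE.
rewrite eE (section_transition (J := J)); last first.
  exact: (pi_overlap_torus (an t0) (a'n t0) (Ia t) (Ja' t) (a'0 t)).
rewrite (superfun_eval_lowest _ (c := c) (p := p)) //; last first.
  by move=> j; apply: gr_body_tr_odd.
apply: eq_bigr => B _; congr (_ * _).
  congr (f J _ B); apply/funext => c'.
  rewrite (pi_tr_even_torus (an t0) (a'n t0) (Ia t) (Ja' t) (a'0 t)).
  by rewrite gr_bodyZ gr_body_scale sel'E //.
under eq_bigr => j _ do
  rewrite (pi_tr_odd_torus (an t0) (a'n t0) (Ia t) (Ja' t) (a'0 t)).
rewrite scaler_prod grZ -rmorph_prod gr_scaleE.
congr (_ * (_ * _)).
  by apply: eq_bigr => j _; rewrite sel'E.
by apply: eq_bigr => j _; rewrite selE //; case: ifP; rewrite ?invr1.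
Qed.
End TorusLimit.
End Sections.

(** * The first and the last chart and their weights *)

Section FlagDimensions.
Variables (n : nat) (k : seq nat).
Hypothesis nk : path gtn n (rcons k 0%N).
Local Notation kd := (flag_dim n k).

Lemma flag_dimS_le s : (kd s.+1 <= kd s)%N.
Proof.
have [lt_s|ge_s] := ltnP s (size k); last first.
  by rewrite /flag_dim [X in (X <= _)%N]nth_default.
move: nk; rewrite rcons_path => /andP[/(pathP 0%N)/(_ s lt_s) lt_ks _].
exact: ltnW.
Qed.

Lemma flag_dim_le s : (kd s <= n)%N.
Proof. by elim: s => // s; apply: leq_trans (flag_dimS_le s). Qed.

Lemma first_rows_le (s : 'I_(size k)) : (0 + kd s.+1 <= kd s)%N.
Proof. exact: flag_dimS_le. Qed.

Lemma last_rows_le (s : 'I_(size k)) : (kd s - kd s.+1 + kd s.+1 <= kd s)%N.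
Proof. by rewrite subnK // flag_dimS_le. Qed.

Definition first_chart := interval_chart (o := fun=> 0%N) first_rows_le.
Definition last_chart :=
  interval_chart (o := fun s => kd s - kd s.+1)%N last_rows_le.

Section Weights.
Variables (K : numFieldType) (alpha : nat).

(* The diagonal matrix of size n with entries 1 (for rows below [alpha]) and t
   acts on the rows and columns of the matrices of both charts through the
   positions of the selected rows among 0, ..., n-1. *)
Definition first_weight (t : K) s (i : 'I_(kd s)) : K :=
  if (alpha <= i)%N then t else 1.
Definition last_weight (t : K) s (i : 'I_(kd s)) : K :=
  if (alpha <= i + (n - kd s))%N then t else 1.
Definition first_moved (c : pi_coord first_chart) : bool :=
  (coord_col c < alpha <= coord_row c)%N.
Definition last_moved (c : pi_coord last_chart) : bool :=
  (coord_row c + (n - kd (tag (val c))) < alpha <=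
   coord_col c + (n - kd (tag (val c)).+1))%N.

Lemma first_weight_neq0 t : t != 0 -> forall s i, @first_weight t s i != 0.
Proof. by move=> t0 s i; rewrite /first_weight; case: ifP; rewrite ?oner_neq0. Qed.

Lemma last_weight_neq0 t : t != 0 -> forall s i, @last_weight t s i != 0.
Proof. by move=> t0 s i; rewrite /last_weight; case: ifP; rewrite ?oner_neq0. Qed.

Lemma first_weight_rows t : torus_rows first_chart (@first_weight t).
Proof. by move=> s j; rewrite /first_weight val_idx_enum_interval. Qed.

Lemma last_weight_rows t : torus_rows last_chart (@last_weight t).
Proof.
move=> s j; rewrite /last_weight val_idx_enum_interval.
have := flag_dimS_le s; have := flag_dim_le s.
by move=> h1 h2; congr (if (_ <= _)%N then _ else _); lia.
Qed.

Lemma last_weight0 t : @last_weight t 0 =1 @first_weight t 0.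
Proof. by move=> i; rewrite /last_weight /first_weight subnn addn0. Qed.

(** A free row has a larger index than the row selected by any column, so the quotient of their
    weights is never 1/t. *)
Lemma first_weightE t c : t != 0 ->
  @torus_weight _ _ _ first_chart (@first_weight t) c =
  if first_moved c then t else 1.
Proof.
move=> t0; have := valP c; rewrite inE add0n /= -leqNgt => row_ge.
have col_lt := ltn_ord (coord_col c).
rewrite /torus_weight /first_weight /first_moved.
have rc : (coord_col c < coord_row c)%N by apply: leq_trans row_ge.
case: (leqP alpha (coord_col c)) => [ac|_] /=.
  by rewrite (leq_trans ac (ltnW rc)) divff.
by rewrite divr1.
Qed.

(** Here the free rows precede the selected ones, so the quotient is never t. *)
Lemma last_weightE t c : t != 0 ->
  @torus_weight _ _ _ last_chart (@last_weight t) c =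
  if last_moved c then t^-1 else 1.
Proof.
move=> t0; have row_out : (coord_row c < kd (tag (val c)) - kd (tag (val c)).+1)%N.
  have := valP c; rewrite inE -/(coord_row c) subnK ?flag_dimS_le //.
  by rewrite ltn_ord andbT -ltnNge.
have h1 := flag_dimS_le (tag (val c)); have h2 := flag_dim_le (tag (val c)).
rewrite /torus_weight /last_weight /last_moved.
have rc : (coord_row c + (n - kd (tag (val c))) <
    coord_col c + (n - kd (tag (val c)).+1))%N by lia.
case: (leqP alpha (coord_row c + _)%N) => [ac|_] /=.
  by rewrite (leq_trans ac (ltnW rc)) divff.
by case: ifP => _; rewrite ?divr1 // div1r.
Qed.
End Weights.
End FlagDimensions.

(** * Global sections are constant *)

Section GlobalSections.
Variables (R : realType) (n : nat) (k : seq nat).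
Hypothesis nk : path gtn n (rcons k 0%N).
Local Notation C := R[i].
Local Notation kd := (flag_dim n k).
Local Notation X := (pi_flag n k C).
Local Notation I0 := (first_chart nk).
Local Notation J0 := (last_chart nk).
Variable f : cochain X.
Arguments f : clear implicits.
Hypothesis fH0 : H0 X f.

Lemma section_orbit alpha p (c : C) (A : {set pi_coord I0}) (x : pi_coord I0 -> C) :
  cst_mod p c (f J0) -> #|A| = p -> pi_overlap J0 x ->
  exists h : C -> C, [/\ continuous0 h,
    forall t, f I0 (fun c => (if first_moved alpha c then t else 1) * x c) A = h 0 &
    h 0 = (\prod_(c in A) if first_moved alpha c then 0 else 1) * h 0].
Proof.
move=> fJ Ap xJ.
apply: (section_torus fH0 (a := first_weight alpha) (a' := last_weight alpha)
  _ _ _ _ _ _ _ fJ Ap xJ).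
- exact: first_weight_neq0.
- exact: last_weight_neq0.
- exact: first_weight_rows.
- exact: last_weight_rows.
- exact: last_weight0.
- exact: first_weightE.
- exact: last_weightE.
Qed.

(** No coordinate is fixed by all the subgroups: this kills each coefficient of positive degree and
    lets every point be contracted to the origin. *)
Lemma first_movedP (c : pi_coord I0) : first_moved (coord_row c) c.
Proof.
rewrite /first_moved leqnn andbT.
have := valP c; rewrite inE add0n /= -leqNgt; apply: leq_trans.
exact: ltn_ord.
Qed.

Lemma section_odd_coeff p (c : C) (A : {set pi_coord I0}) (x : pi_coord I0 -> C) :
  (0 < p)%N -> cst_mod p c (f J0) -> #|A| = p -> f I0 x A = 0.
Proof.
move=> p0 fJ Ap; move: x.
apply: (@pi_overlap_dense R n k I0 J0 (fun x => f I0 x A) (fun=> 0)).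
- by move=> x v; apply: section_line0.
- by move=> x v; apply: continuous0_cst.
move=> x xJ; have [c0 c0A] : exists c0, c0 \in A.
  by apply/set0Pn; rewrite -cards_eq0 Ap -lt0n.
have [h [_ hE h0]] := section_orbit (coord_row c0) fJ Ap xJ.
(* The orbit passes through x at t = 1, and the factor of [c0] in the limit is 0. *)
have := hE 1; rewrite h0 (bigD1 c0) //= first_movedP !mul0r => <-.
by congr (f I0 _ A); apply/funext => c'; rewrite if_same mul1r.
Qed.

(** The body is constant along the orbit, limit point t = 0 included; the two sides are its values
    at t = 1 and t = 0. *)
Lemma section_body alpha (x : pi_coord I0 -> C) :
  f I0 x finset.set0 =
  f I0 (fun c => (if first_moved alpha c then 0 else 1) * x c) finset.set0.
Proof.
move: x; apply: (@pi_overlap_dense R n k I0 J0 (fun x => f I0 x finset.set0)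
  (fun x => f I0 (fun c => (if first_moved alpha c then 0 else 1) * x c) finset.set0)).
- by move=> x v; apply: section_line0.
- move=> x v; pose e (c : pi_coord I0) : C := if first_moved alpha c then 0 else 1.
  rewrite (_ : (fun t => _) = fun t =>
    f I0 (fun c => e c * x c + t * (e c * v c)) finset.set0).
    exact: section_line0.
  apply/funext => t; congr (f I0 _ _); apply/funext => c.
  by rewrite -/(e c) mulrDr mulrCA.
move=> x xJ.
have fJ : cst_mod 0 (0 : C) (f J0) by [].
have [h [_ hE _]] := section_orbit alpha fJ (cards0 _) xJ.
rewrite hE -(hE 1); congr (f I0 _ _); apply/funext => c'.
by rewrite if_same mul1r.
Qed.

(** The contractions for all alpha below n are composed; the one whose alpha is the row of a
    coordinate sets that coordinate to 0. *)
Lemma section_body_cst (x : pi_coord I0 -> C) :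
  f I0 x finset.set0 = f I0 (fun=> 0) finset.set0.
Proof.
have cut m : f I0 x finset.set0 = f I0 (fun c =>
    (if has (fun alpha => first_moved alpha c) (iota 0 m) then 0 else 1) * x c) finset.set0.
  elim: m => [|m ->].
    by congr (f I0 _ _); apply/funext => c; rewrite mul1r.
  rewrite (section_body m); congr (f I0 _ _); apply/funext => c.
  rewrite mulrA -[in RHS]addn1 iotaD has_cat /= orbF add0n.
  by case: (has _ _); case: (first_moved _ _); rewrite !(mul0r, mul1r).
rewrite (cut n); congr (f I0 _ _); apply/funext => c.
rewrite (_ : has _ _) ?mul0r //; apply/hasP; exists (coord_row c : nat).
  rewrite mem_iota /= add0n; apply: leq_trans (flag_dim_le nk (tag (val c))).
  exact: ltn_ord.
exact: first_movedP.
Qed.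

(** The torus argument in degree p needs the lower degrees in the last chart, so the induction
    hypothesis is first carried over there. *)
Lemma section_cst_mod p : cst_mod p (f I0 (fun=> 0) finset.set0) (f I0).
Proof.
elim: p => [//|p IHp] A x; rewrite ltnS leq_eqVlt => /orP[/eqP Ap|]; last exact: IHp.
case: p => [|p] in IHp Ap *.
  move/eqP: Ap; rewrite cards_eq0 => /eqP ->.
  by rewrite eqxx mul1r section_body_cst.
have /negbTE -> : A != finset.set0 by rewrite -cards_eq0 Ap.
rewrite mul0r; apply: section_odd_coeff Ap => //.
exact: (cst_mod_chart fH0 IHp).
Qed.

Lemma section_cst I (x : pi_coord I -> C) :
  f I x = (f I0 (fun=> 0) finset.set0)%:A.
Proof.
apply/ffunP => A; rewrite grZ gr1 mulrC.
have fI := @cst_mod_chart R n k f fH0 #|A|.+1 _ I0 I (@section_cst_mod _).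
by rewrite fI.
Qed.
End GlobalSections.

(** * Constants as global sections *)

Section ConstantSections.
Variables (R : realType) (n : nat) (k : seq nat).
Local Notation C := R[i].
Local Notation X := (pi_flag n k C).

Definition cst_cochain (c : C^o) : cochain X := fun _ _ => c%:A.

Fact cst_cochain_linear : linear cst_cochain.
Proof.
move=> b u v; apply: cochain_ext => i x; rewrite /cst_cochain scalerDl.
by rewrite -[b *: u]/(b * u) -scalerA.
Qed.
HB.instance Definition _ := GRing.isLinear.Build C C^o (cochain X) *:%R
  cst_cochain cst_cochain_linear.

Lemma cst_cochain_monoid : GRing.monoid_morphism cst_cochain.
Proof.
split; first by apply: cochain_ext => i x; rewrite /cst_cochain scale1r.
move=> u v; apply: cochain_ext => i x.
by rewrite /cst_cochain -[RHS]/(u%:A * v%:A) -scalerAl mul1r scalerA.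
Qed.

Lemma cst_cochain_even a : even_cochain (cst_cochain a).
Proof.
move=> i x A oA; rewrite grZ gr1; case: eqP oA => [->|_ _]; last by rewrite mulr0.
by rewrite cards0.
Qed.

Lemma analytic_cst (K : numFieldType) (E : finType) (c : K) (a : E -> K) :
  analytic_at (fun=> c) a.
Proof.
exists (fun m => if [forall i, m i == 0%N] then c else 0), 1, `|c|; split=> //.
  move=> m; rewrite expr1n mulr1; case: ifP => // _.
  by rewrite normr0.
(* The box of side 0 can be empty; from side 1 on it contains the zero multi-index and the partial
   sum is exactly c. *)
move=> h _; apply/cvgrPdist_lt => e e0; exists 1%N => // -[|N] // _ /=.
rewrite [X in c - X](_ : _ = c) ?subrr ?normr0 //.
rewrite (bigD1 [ffun=> ord0]) //= [X in _ + X]big1 ?addr0 => [|m m0].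
  case: forallP => [_|[] i]; last by rewrite ffunE.
  by rewrite big1 ?mulr1 // => i _; rewrite ffunE.
case: forallP => [mz|_]; last by rewrite mul0r.
case/eqP: m0; apply/ffunP => i; rewrite ffunE; apply/val_inj/eqP.
exact: mz.
Qed.

Lemma cst_cochain_H0 a : H0 X (cst_cochain a).
Proof.
split=> [i A x|i j x _]; last by rewrite /cst_cochain superfun_eval_cst.
exact: analytic_cst.
Qed.
End ConstantSections.

Theorem theorem8 (R : realType) (n : nat) (k : seq nat) :
  path gtn n (rcons k 0%N) ->
  exists phi : {linear R[i]^o -> cochain (pi_flag n k R[i])},
    [/\ GRing.monoid_morphism phi,
        (forall a, even_cochain (phi a)),
        injective phi
      & range phi = H0 (pi_flag n k R[i])].
Proof.
move=> nk; exists (@cst_cochain R n k : {linear R[i]^o -> cochain (pi_flag n k R[i])}).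
split.
- exact: cst_cochain_monoid.
- exact: cst_cochain_even.
- move=> a b ab.
  (* Injectivity rests on the existence of a chart: the constant is read off at the origin of the
     first one. *)
  have : @cst_cochain R n k a (first_chart nk) (fun=> 0) finset.set0 =
    @cst_cochain R n k b (first_chart nk) (fun=> 0) finset.set0.
    by rewrite [cst_cochain a]ab.
  by rewrite /cst_cochain !grZ gr1 eqxx !mulr1.
- apply/seteqP; split=> [_ [a _ <-]|f fH0]; first exact: cst_cochain_H0.
  exists (f (first_chart nk) (fun=> 0) finset.set0) => //.
  by apply: cochain_ext => i x; apply/esym; apply: (section_cst nk fH0).
Qed.
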